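(* Let $K$ be a (locally compact) hypergroup whose topology has a countable basis and which admits a right-invariant Haar measure. Then $K$ has the normed convergence property if and only if $K$ is compact.
   Context: A (locally compact) hypergroup is taken in the standard sense (Jewett; Bloom–Heyer). It is a nonempty locally compact Hausdorff space $K$ together with an associative bilinear operation $*$ (convolution) on the space of bounded regular Borel measures on $K$, with convolution given by $\mu*\nu=\int\int \delta_x*\delta_y\,d\mu(x)\,d\nu(y)$, such that: (i) for all $x,y\in K$, $\delta_x*\delta_y$ is a probability measure with compact support; (ii) $(x,y)\mapsto\delta_x*\delta_y$ is continuous for the weak topology on probability measures; (iii) $(x,y)\mapsto \mathrm{supp}(\delta_x*\delta_y)$ is continuous into the space of nonempty compact subsets of $K$ with the Michael topology (generated by the sets $\{A : A\cap U\neq\emptyset,\ A\subset V\}$, with $U,V\subset K$ open); (iv) there is an element $e\in K$ with $\delta_e*\delta_x=\delta_x*\delta_e=\delta_x$ for all $x\in K$; (v) there is an involutive homeomorphism $x\mapsto x^-$ of $K$ such that $(\delta_x*\delta_y)^-=\delta_{y^-}*\delta_{x^-}$ (where $\mu^-$ is the image of $\mu$ under the involution), and $e\in\mathrm{supp}(\delta_x*\delta_y)$ if and only if $x=y^-$. Here $\delta_x$ denotes the probability measure concentrated at $x$. For a function $f$ on $K$, write $f(xy)=\int f\,d(\delta_x*\delta_y)$. A right-invariant Haar measure is a nonzero non-negative regular Borel (Radon) measure $m$ on $K$ such that $\int f(yx)\,dm(y)=\int f(y)\,dm(y)$ for all $x\in K$ and all continuous compactly supported $f$. ${\mathcal P}(K)$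 is the space of all regular Borel probability measures on $K$ with the weak topology, i.e. the weakest topology for which $\mu\mapsto\int f\,d\mu$ is continuous for every bounded continuous function $f$ on $K$. For $x\in K$ and $\mu,\mu_1,\mu_2\in{\mathcal P}(K)$, write $x\mu=\delta_x*\mu$ and $\mu_1\mu_2=\mu_1*\mu_2$. Definition: $K$ has the normed convergence property if for every sequence $(\mu_n)_{n\ge1}$ in ${\mathcal P}(K)$ there exists a sequence $(x_n)_{n\ge1}$ in $K$ such that $(x_n\nu_n)_{n\ge1}$ is relatively compact in ${\mathcal P}(K)$, where $\nu_n=\mu_n\cdots\mu_2\mu_1$ for all $n\ge1$. *)

(* Defs.v *)
From HB Require Import structures.
From mathcomp Require Import all_boot all_order all_algebra.
From mathcomp Require Import all_classical all_reals all_analysis.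

Set Implicit Arguments.
Unset Strict Implicit.
Unset Printing Implicit Defensive.

Import Order.TTheory GRing.Theory Num.Theory.
Import numFieldNormedType.Exports.

Local Open Scope classical_set_scope.
Local Open Scope ring_scope.

(* A [ptopologicalType] is a nonempty topological space; its distinguished point
   plays no role below and need not be the unit of a hypergroup. *)

(* Library measures and charges are total functions on [set T] whose values on
   non-measurable sets carry no meaning, so equality of two measures is always
   stated as agreement on the Borel sets ([same_measure]). *)

Definition borel (K : ptopologicalType) : Type := g_sigma_algebraType (@open K).
HB.instance Definition _ (K : ptopologicalType) :=
  Measurable.copy (borel K) (g_sigma_algebraType (@open K)).

Definition same_measure (R : realType) (K : ptopologicalType)
    (mu nu : set (borel K) -> \bar R) : Prop :=
  forall A : set (borel K), measurable A -> mu A = nu A.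

(* Regularity of a finite, possibly signed, measure: the last clause says that
   the total variation of [mu] on [U `\` C] is small. *)
Definition regular (R : realType) (K : ptopologicalType)
    (mu : set (borel K) -> \bar R) : Prop :=
  forall A : set (borel K), measurable A -> forall eps : R, 0 < eps ->
  exists C U : set K, [/\ compact C, open U, C `<=` A, A `<=` U &
    forall B : set (borel K), measurable B -> B `<=` U `\` C ->
      (`|mu B| < eps%:E)%E].

Definition supp (R : realType) (K : ptopologicalType)
    (mu : set (borel K) -> \bar R) : set K :=
  [set x | forall U : set K, open U -> U x -> (0 < mu U)%E].

Section bounded_measures.
Context (R : realType) (K : ptopologicalType).

(* The real vector space of bounded regular (signed) Borel measures. *)
Record bmeasure := BMeasure {
  bm_charge :> {charge set (borel K) -> \bar R};
  bm_regular : regular bm_charge }.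

Lemma regular_cadd (mu nu : bmeasure) : regular (cadd mu nu).
Proof.
move=> A mA eps eps0; have e2 : 0 < eps / 2 by rewrite divr_gt0.
have [C [U [cC oU CA AU small]]] := bm_regular mu mA e2.
have [D [V [cD oV DA AV small']]] := bm_regular nu mA e2.
exists (C `|` D), (U `&` V); split.
- exact: compactU.
- exact: openI.
- by rewrite subUset.
- by rewrite subsetI.
- move=> B mB BUC; rewrite /cadd /= [eps]splitr EFinD.
  apply: (le_lt_trans (lee_abs_add _ _)); apply: lteD.
  + by apply: small => // x /BUC[[? _]] /not_orP[].
  + by apply: small' => // x /BUC[[_ ?]] /not_orP[].
Qed.

Definition bm_add (mu nu : bmeasure) : bmeasure :=
  BMeasure (regular_cadd mu nu).

Lemma regular_cscale (a : R) (mu : bmeasure) : regular (cscale a mu).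
Proof.
move=> A mA eps eps0.
have a0 : 0 < `|a| + 1 by rewrite ltr_wpDl.
have [C [U [cC oU CA AU small]]] := bm_regular mu mA (divr_gt0 eps0 a0).
exists C, U; split=> // B mB BUC; rewrite /cscale abseM.
have := small B mB BUC.
have /fineK <- : mu B \is a fin_num by exact: fin_num_measure.
rewrite !abse_EFin -EFinM !lte_fin ltr_pdivlMr// mulrC => h.
by apply: le_lt_trans h; rewrite ler_wpM2r// lerDl.
Qed.

Definition bm_scale (a : R) (mu : bmeasure) : bmeasure :=
  BMeasure (regular_cscale a mu).

Definition hahn (mu : {charge set (borel K) -> \bar R}) :
    {PN : set (borel K) * set (borel K) | hahn_decomposition mu PN.1 PN.2}.
Proof.
apply: cid; have [P [N h]] := Hahn_decomposition mu.
by exists (P, N).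
Defined.

(* Integral against a signed measure, through its Jordan decomposition (which
   does not depend on the Hahn decomposition chosen by [hahn]). *)
Definition cint (mu : {charge set (borel K) -> \bar R}) (f : K -> R) : R :=
  \int[jordan_pos (svalP (hahn mu))]_x f x -
  \int[jordan_neg (svalP (hahn mu))]_x f x.

(* The elements of P(K). *)
Record rprobability := RProbability {
  rp_prob :> probability (borel K) R;
  rp_regular : regular rp_prob }.

HB.instance Definition _ := gen_eqMixin rprobability.
HB.instance Definition _ := gen_choiceMixin rprobability.

Definition bounded_continuous : Type :=
  {f : K -> R | continuous f /\ bounded_fun f}.

Definition weak_ev (f : bounded_continuous) (mu : rprobability) : R :=
  \int[mu]_x sval f x.

HB.instance Definition _ := Topological.copy rprobability
  (sup_topology (fun f : bounded_continuous =>
     Topological.on (initial_topology (weak_ev f)))).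

Definition bm_of_rp (mu : rprobability) : bmeasure :=
  @BMeasure (charge_of_finite_measure mu) (rp_regular mu).

End bounded_measures.
Arguments bmeasure : clear implicits.
Arguments rprobability : clear implicits.

Section bounded_measures_lemmas.
Context (R : realType) (K : ptopologicalType).

Lemma cint_measure (mu : rprobability R K) (f : K -> R) :
  cint (bm_of_rp mu) f = \int[mu]_x f x.
Proof.
rewrite /cint; move: (hahn _) => [[P N] /= PN].
have [[mP Pp] [mN Nn] PNT PN0] := PN.
have N0 A : measurable A -> mu (A `&` N) = 0%E.
  move=> mA; apply/eqP; rewrite eq_le measure_ge0 andbT.
  by apply: Nn; [exact: measurableI | exact: subIsetr].
have neg0 A : measurable A -> jordan_neg PN A = 0%E.
  move=> mA; rewrite jordan_negE cjordan_negE /crestr0 mem_set// /crestr.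
  by rewrite [X in (- X)%E](N0 A mA) oppe0.
have pos A : measurable A -> jordan_pos PN A = mu A.
  move=> mA; rewrite jordan_posE cjordan_posE /crestr0 mem_set// /crestr.
  have := charge_partition (bm_of_rp mu) mA mP mN PNT PN0.
  by rewrite [X in (_ + X)%E](N0 A mA) adde0 => <-.
rewrite /Rintegral.
rewrite (@eq_measure_integral _ _ _ setT mu (jordan_pos PN)); last first.
  by move=> A mA _; exact: pos.
rewrite (@eq_measure_integral _ _ _ setT mzero (jordan_neg PN)); last first.
  by move=> A mA _; exact: neg0.
by rewrite integral_measure_zero/= subr0.
Qed.

Lemma regular_dirac (hK : hausdorff_space K) (x : K) :
  regular (\d_(x : borel K) : set (borel K) -> \bar R).
Proof.
move=> A mA eps eps0; have [Ax|nAx] := pselect (A x).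
  exists [set x], setT; split => //.
  - exact: compact_set1.
  - exact: openT.
  - by move=> _ ->.
  move=> B mB BUC; rewrite diracE memNset ?abse0 ?lte_fin// => /BUC[_].
  by apply.
exists set0, (~` [set x]); split => //.
- exact: compact0.
- by apply/closed_openC/accessible_closed_set1/hausdorff_accessible.
- by move=> y Ay /= yx; apply: nAx; rewrite -yx.
- move=> B mB BUC; rewrite diracE memNset ?abse0 ?lte_fin// => /BUC[+ _].
  by apply.
Qed.

Definition rp_dirac (hK : hausdorff_space K) (x : K) : rprobability R K :=
  @RProbability R K (dirac (x : borel K)) (regular_dirac hK x).

End bounded_measures_lemmas.

Record ncompact (K : ptopologicalType) := NCompact {
  nc_set :> set K;
  nc_compact : compact nc_set;
  nc_nonempty : nc_set !=set0 }.

HB.instance Definition _ (K : ptopologicalType) := gen_eqMixin (ncompact K).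
HB.instance Definition _ (K : ptopologicalType) := gen_choiceMixin (ncompact K).

(* The Michael topology. *)
HB.instance Definition _ (K : ptopologicalType) :=
  isSubBaseTopological.Build (ncompact K)
    [set UV : set K * set K | open UV.1 /\ open UV.2]
    (fun UV => [set A : ncompact K | nc_set A `&` UV.1 !=set0 /\
                                     nc_set A `<=` UV.2]).

(* [hg_point x y] is the measure delta_x * delta_y as an element of P(K), and
   [hg_supp x y] is its support as a nonempty compact set; both are determined,
   up to values on non-Borel sets, by [hg_pointE] and [hg_suppE]. *)
Record hypergroup (R : realType) (K : ptopologicalType) := Hypergroup {
  hg_hausdorff : hausdorff_space K;
  hg_locally_compact : locally_compact [set: K];
  hg_conv : bmeasure R K -> bmeasure R K -> bmeasure R K;
  hg_convDl : forall mu mu' nu, same_measure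
    (hg_conv (bm_add mu mu') nu) (bm_add (hg_conv mu nu) (hg_conv mu' nu));
  hg_convDr : forall mu nu nu', same_measure
    (hg_conv mu (bm_add nu nu')) (bm_add (hg_conv mu nu) (hg_conv mu nu'));
  hg_convZl : forall a mu nu, same_measure
    (hg_conv (bm_scale a mu) nu) (bm_scale a (hg_conv mu nu));
  hg_convZr : forall a mu nu, same_measure
    (hg_conv mu (bm_scale a nu)) (bm_scale a (hg_conv mu nu));
  hg_convA : forall mu nu lam, same_measure
    (hg_conv (hg_conv mu nu) lam) (hg_conv mu (hg_conv nu lam));
  hg_dirac := fun x : K => bm_of_rp (rp_dirac R hg_hausdorff x);
  hg_point : K -> K -> rprobability R K;
  hg_pointE : forall x y, same_measure
    (hg_conv (hg_dirac x) (hg_dirac y)) (hg_point x y);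
  hg_convE : forall mu nu (A : set (borel K)), measurable A ->
    hg_conv mu nu A =
    (cint nu (fun y => cint mu (fun x => fine (hg_point x y A))))%:E;
  hg_point_continuous : continuous (fun xy : K * K => hg_point xy.1 xy.2);
  hg_supp : K -> K -> ncompact K;
  hg_suppE : forall x y, nc_set (hg_supp x y) = supp (hg_point x y);
  hg_supp_continuous : continuous (fun xy : K * K => hg_supp xy.1 xy.2);
  hg_unit : K;
  hg_mul1 : forall x, same_measure
    (hg_conv (hg_dirac hg_unit) (hg_dirac x)) (hg_dirac x);
  hg_mulr1 : forall x, same_measure
    (hg_conv (hg_dirac x) (hg_dirac hg_unit)) (hg_dirac x);
  hg_inv : K -> K;
  hg_inv_continuous : continuous hg_inv;
  hg_invK : involutive hg_inv;
  hg_invM : forall x y, same_measure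
    (pushforward (hg_conv (hg_dirac x) (hg_dirac y))
      (hg_inv : borel K -> borel K))
    (hg_conv (hg_dirac (hg_inv y)) (hg_dirac (hg_inv x)));
  hg_unit_supp : forall x y,
    supp (hg_conv (hg_dirac x) (hg_dirac y)) hg_unit <-> x = hg_inv y }.

Section product.
Context (R : realType) (K : ptopologicalType) (H : hypergroup R K).
Variables mu nu : rprobability R K.

Let conv := hg_conv H (bm_of_rp mu) (bm_of_rp nu).

(* Extending [conv] by 0 to non-Borel sets makes it nonnegative everywhere. *)
Let conv0 := crestr0 conv (@measurableT _ (borel K)).

Let conv0E A : measurable A -> conv0 A = conv A.
Proof. by move=> mA; rewrite /conv0 /crestr0 mem_set// /crestr setIT. Qed.

Let conv_ge0 (A : set (borel K)) : measurable A -> (0 <= conv A)%E.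
Proof.
move=> mA; rewrite /conv hg_convE// cint_measure lee_fin.
apply: Rintegral_ge0 => // y _; rewrite cint_measure.
by apply: Rintegral_ge0 => // x _; exact: fine_ge0.
Qed.

Let conv0_ge0 A : (0 <= conv0 A)%E.
Proof.
have [mA|nA] := pselect (measurable A); first by rewrite conv0E// conv_ge0.
by rewrite /conv0 /crestr0 memNset.
Qed.

Definition rp_mul_measure : set (borel K) -> \bar R :=
  measure_of_charge conv0 conv0_ge0.

HB.instance Definition _ := Measure.on rp_mul_measure.

Lemma rp_mul_measureE : same_measure rp_mul_measure conv.
Proof. exact: conv0E. Qed.

Let rp_mul_measureT : rp_mul_measure setT = 1%E.
Proof.
rewrite rp_mul_measureE// /conv hg_convE// cint_measure.
have int1 (P : rprobability R K) : \int[P]_x (1 : R) = 1.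
  by rewrite Rintegral_cst// [X in fine X](probability_setT P) mul1r.
rewrite (_ : (fun _ => _) = cst 1) ?int1//; apply/funext => y.
rewrite cint_measure (_ : (fun _ => _) = cst 1) ?int1//; apply/funext => x.
by rewrite [X in fine X](probability_setT (hg_point H x y)).
Qed.

HB.instance Definition _ :=
  Measure_isProbability.Build _ _ _ rp_mul_measure rp_mul_measureT.

Let rp_mul_regular : regular rp_mul_measure.
Proof.
move=> A mA eps eps0; have [C [U [cC oU CA AU small]]] :=
  bm_regular conv mA eps0.
by exists C, U; split => // B mB BUC; rewrite rp_mul_measureE//; exact: small.
Qed.

(* The product of P(K): the convolution product, as an element of P(K). *)
Definition rp_mul : rprobability R K :=
  @RProbability R K rp_mul_measure rp_mul_regular.

Lemma rp_mulE :
  same_measure rp_mul (hg_conv H (bm_of_rp mu) (bm_of_rp nu)).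
Proof. exact: rp_mul_measureE. Qed.

End product.

(* f(xy) *)
Definition hg_eval (R : realType) (K : ptopologicalType) (H : hypergroup R K)
    (f : K -> R) (x y : K) : R :=
  \int[hg_point H x y]_z f z.

Definition radon (R : realType) (K : ptopologicalType)
    (m : {measure set (borel K) -> \bar R}) : Prop :=
  [/\ forall C : set K, compact C -> (m C < +oo)%E,
      forall A : set (borel K), measurable A ->
        m A = ereal_inf [set m U | U in [set U : set K | open U /\ A `<=` U]] &
      forall U : set K, open U ->
        m U = ereal_sup [set m C | C in [set C : set K | compact C /\ C `<=` U]]].

Definition right_haar (R : realType) (K : ptopologicalType)
    (H : hypergroup R K) (m : {measure set (borel K) -> \bar R}) : Prop :=
  [/\ radon m, m setT <> 0%E &
      forall (x : K) (f : K -> R), continuous f ->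
        compact (closure [set y | f y != 0]) ->
        (\int[m]_y (hg_eval H f y x)%:E = \int[m]_y (f y)%:E)%E].

(* Sequences are indexed from 0, so [rp_prod H mu n] is
   mu_n * ... * mu_1 * mu_0. *)
Fixpoint rp_prod (R : realType) (K : ptopologicalType) (H : hypergroup R K)
    (mu : nat -> rprobability R K) (n : nat) : rprobability R K :=
  if n is k.+1 then rp_mul H (mu k.+1) (rp_prod H mu k) else mu 0%N.

Definition normed_convergence_property (R : realType) (K : ptopologicalType)
    (H : hypergroup R K) : Prop :=
  forall mu : nat -> rprobability R K, exists x : nat -> K,
    precompact (range (fun n : nat =>
      rp_mul H (rp_dirac R (hg_hausdorff H) (x n)) (rp_prod H mu n))).

(* Main.v *)
(* If K is compact then P(K) is compact: along an ultrafilter of probability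
   measures the integrals of each continuous function converge, and the limit
   functional is represented by a measure (Riesz).
   Conversely let K be noncompact, and let m be the image under the involution
   of a right Haar measure, so that m is invariant under left translations.
   The support relations c in {y}*{z} => z in {y^-}*{c}, y in {c}*{z^-} produce
   infinitely many disjoint translates of a fixed compact set, so m has infinite
   mass.  If mu is the restriction of m to a compact set D, normalised, then
   delta_x * mu <= m / m(D) on nice sets, uniformly in x.  Choosing D large
   depending on nu and C therefore makes sup_x (delta_x * mu * nu)(C)
   arbitrarily small.  Doing this at step n with the n-th set of a compact
   exhaustion of K gives products nu_n such that the mass of delta_(x_n) * nu_n
   escapes to infinity whatever the x_n are. *)

From HB Require Import structures.
Require Import Defs.
From mathcomp Require Import all_boot all_order all_algebra.
From mathcomp Require Import all_classical all_reals all_analysis.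
From mathcomp Require Import measurable_realfun lra.

Set Implicit Arguments.
Unset Strict Implicit.
Unset Printing Implicit Defensive.

Import Order.TTheory GRing.Theory Num.Theory.
Import numFieldNormedType.Exports.

Local Open Scope classical_set_scope.
Local Open Scope ring_scope.

(** [hg_convE] expresses a convolution through iterated integrals of [fine (hg_point H x y A)],
    whose measurability in [x] and in [y] is not established. The estimates are therefore one-sided:
    lower integrals are monotone without measurability, and bounds pass through the functions
    [hg_eval H f], which are continuous because [hg_point] is weakly continuous. Left invariance is
    the right kind because the new factor mu_n stands leftmost in nu_n, next to the arbitrary
    delta_x: the bound on delta_x * mu_n is then uniform in x, and the older factors, almost carried
    by a compact set, only enlarge the compact set to be avoided. Translation by a point has no
    inverse here; the support relations replace cancellation. They hold because axiom (v) decides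
    when the unit lies in {w}*{z}, and associativity transfers this to other points. Second
    countability turns local data into countable unions: supports get full mass, finite measures
    become regular, open sets become Carathéodory measurable, and compact sets exhaust K. *)

(** * Topology and integration preliminaries *)

(* The sets satisfying P form an ideal: a property that is local and stable under
   finite unions holds on compact sets. *)
Lemma compact_ideal (T : topologicalType) (C : set T) (P : set (set T)) :
  compact C -> P set0 -> (forall A B, P A -> P B -> P (A `|` B)) ->
  (forall A B, A `<=` B -> P B -> P A) ->
  (forall x, C x -> exists2 N, nbhs x N & P N) -> P C.
Proof.
move=> cC P0 PU PS PC; apply: contrapT => nPC.
(* If [P C] fails, this filter is proper; at a cluster point in [C], the local hypothesis puts the
   complement of a neighbourhood into it. *)
pose F := [set A : set T | P (C `\` A)].
have FF : ProperFilter F.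
  split; first by rewrite /F /= setD0.
  split; rewrite /F /=.
  - by rewrite setDT.
  - move=> A B PA PB; rewrite /= setDIr; exact: PU.
  - by move=> A B AB; apply: PS; exact: setDS.
have [|x [Cx /(_ _ _)]] := cC F FF; first by rewrite /F /= setDv.
have [N xN PN] := PC x Cx.
move=> /(_ (~` N) N) []//; last by move=> y [].
by rewrite /F /=; apply: PS PN => y [_ /contrapT].
Qed.

Lemma compact_sub_nbhs (T : topologicalType) (C : set T) :
  locally_compact [set: T] -> compact C ->
  exists V W : set T, [/\ open V, compact W, closed W, C `<=` V & V `<=` W].
Proof.
move=> lcT cC.
apply: (compact_ideal (P := fun A => exists V W : set T,
  [/\ open V, compact W, closed W, A `<=` V & V `<=` W])) cC _ _ _ _.
- by exists set0, set0; split => //; [exact: open0|exact: compact0|exact: closed0].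
- move=> A B [V [W [oV cW clW AV VW]]] [V' [W' [oV' cW' clW' BV VW']]].
  exists (V `|` V'), (W `|` W'); split.
  + exact: openU.
  + exact: compactU.
  + exact: closedU.
  + exact: setUSS.
  + exact: setUSS.
- move=> A B AB [V [W [oV cW clW BV VW]]]; exists V, W; split => //.
  exact: subset_trans BV.
- move=> x _; have [W] := lcT x I.
  rewrite withinET => xW [cW clW].
  exists W°; first by apply: nbhs_interior.
  by exists W°, W; split => //; [exact: open_interior|exact: interior_subset].
Qed.

Section urysohn.
Context (R : realType) (T : topologicalType).
Hypotheses (hT : hausdorff_space T) (lcT : locally_compact [set: T]).

(** The space itself need not be normal, but its one-point compactification is, so Urysohn's lemma
    is applied there. Cutting [U] down to a relatively compact neighbourhood of [C] makes the
    function vanish at infinity and have compact support. *)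
Lemma compact_bump (C U : set T) : compact C -> open U -> C `<=` U ->
  exists f : T -> R, [/\ continuous f, forall x, 0 <= f x <= 1,
    forall x, C x -> f x = 1, forall x, f x != 0 -> U x &
    compact (closure [set x | f x != 0])].
Proof.
move=> cC oU CU.
have [V [W [oV cW clW CV VW]]] := compact_sub_nbhs lcT cC.
pose X := one_point_compactification T.
have hX : hausdorff_space X by exact: one_point_compactification_hausdorff.
have nX : normal_space X.
  exact: compact_normal hX (@one_point_compactification_compact _).
have sc := @one_point_compactification_some_continuous T.
have clC : closed (Some @` C : set X).
  apply: compact_closed => //; apply: continuous_compact => //.
  by apply: continuous_subspaceT => x; exact: sc.
have clV : closed (~` (Some @` (U `&` V)) : set X).
  by apply/open_closedC/one_point_compactification_open_some; exact: openI.
have /(@uniform_separatorP _ R) [f [cf f01 f1 f0]] :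
    @uniform_separator X (~` (Some @` (U `&` V))) (Some @` C).
  apply: ((@normal_separatorP R _).1 nX) => //.
  by apply/disjoints_subset; apply: subsetC => _ [x Cx <-]; exists x => //; split; [exact: CU|exact: CV].
have fUV x : f (Some x) != 0 -> (U `&` V) x.
  move=> /eqP fx0; apply: contrapT => nUV; apply: fx0; apply: f1.
  by exists (Some x : X) => // -[y UVy [yx]]; apply: nUV; rewrite -yx.
exists (fun x => f (Some x)); split.
- by move=> x; apply: (@continuous_comp _ _ _ (Some : T -> X) f); [exact: sc|exact: cf].
- by move=> x; have /f01 : range f (f (Some x)) by exists (Some x : X); rewrite /= ?in_itv.
- by move=> x Cx; apply: f0; exists (Some x : X) => //; exists x.
- by move=> x /fUV[].
- apply: (subclosed_compact _ cW); first exact: closed_closure.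
  move/closure_id : clW => ->; apply: closureS => x /= /fUV[_]; exact: VW.
Qed.

Lemma locally_compact_regular (x : T) (U : set T) : nbhs x U ->
  exists C : set T, [/\ compact C, nbhs x C & C `<=` U].
Proof.
move=> xU; have [W] := lcT (x := x) I; rewrite withinET => xW [cW clW].
have [A xA AUW] := compact_regular hT cW xW (filterI xU xW).
exists (closure A); split.
- by apply: (subclosed_compact _ cW); [exact: closed_closure|move=> y /AUW[]].
- by apply: filterS xA; exact: subset_closure.
- by move=> y /AUW[].
Qed.

End urysohn.

Lemma second_countable_bigcup (T : topologicalType) (P : set (set T)) (U : set T) :
  @second_countable T -> P set0 ->
  (forall x, U x -> exists A, [/\ P A, nbhs x A & A `<=` U]) ->
  exists2 A : nat -> set T, (forall n, P (A n)) & U = \bigcup_n A n.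
Proof.
move=> [B cB [oB Bx]] P0 PU.
have [g gB] : exists g : nat -> set T, forall b, B b -> exists n, g n = b.
  have /pfcard_geP[B0|[g]] := cB.
    by exists (fun=> set0) => b; rewrite B0.
  exists g => b Bb; have [n _ <-] := @surj _ _ _ _ g _ Bb; by exists n.
pose Q n A := [/\ P A, g n `<=` A & A `<=` U].
exists (fun n => if pselect (exists A, Q n A) is left e then projT1 (cid e) else set0).
  move=> n; case: pselect => // e; by case: (projT2 (cid e)).
apply/seteqP; split => x.
  move=> /PU[A [PA xA AU]].
  have [b [Bb bx] bA] := Bx x A xA; have [n gn] := gB _ Bb.
  exists n => //; case: pselect => [e|]; last by case; exists A; split => //; rewrite gn.
  by case: (projT2 (cid e)) => _ + _; apply; rewrite gn.
by move=> [n _]; case: pselect => // e; case: (projT2 (cid e)) => _ _; exact.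
Qed.

Section integrals.
Import HBNNSimple.
Context d (T : measurableType d) (R : realType).
Implicit Type mu : {measure set T -> \bar R}.

(* Valid for non-measurable functions too: the integral of a nonnegative function
   is defined as the supremum of the integrals of the simple functions below it. *)
Lemma le_lower_integral mu (f g : T -> \bar R) :
  (forall x, 0 <= f x)%E -> (forall x, f x <= g x)%E ->
  (\int[mu]_x f x <= \int[mu]_x g x)%E.
Proof.
move=> f0 fg; have g0 x : (0 <= g x)%E by exact: le_trans (fg x).
rewrite !ge0_integralTE//; apply: ereal_sup_le => _ [h hf <-].
exists h => //= x; exact: le_trans (fg x).
Qed.

Lemma le_lower_Rintegral mu (f g : T -> R) :
  (forall x, 0 <= f x) -> (forall x, f x <= g x) ->
  (\int[mu]_x (g x)%:E < +oo)%E ->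
  \int[mu]_x f x <= \int[mu]_x g x.
Proof.
move=> f0 fg goo.
have fg' : (\int[mu]_x (f x)%:E <= \int[mu]_x (g x)%:E)%E.
  by apply: le_lower_integral => x; rewrite lee_fin.
have f0' : (0 <= \int[mu]_x (f x)%:E)%E by apply: integral_ge0 => x _; rewrite lee_fin.
apply: fine_le => //.
- by rewrite ge0_fin_numE// (le_lt_trans fg').
- by rewrite ge0_fin_numE// (le_trans f0').
Qed.

(** Only an inequality, since [f] may be non-measurable: the simple functions below it may all stay
    away from the value [f a]. *)
Lemma lower_integral_dirac (a : T) (f : T -> R) : (forall x, 0 <= f x) ->
  \int[\d_a]_x f x <= f a.
Proof.
move=> f0; rewrite -lee_fin /Rintegral.
have h : (\int[\d_a]_x (f x)%:E <= (f a)%:E)%E.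
  rewrite ge0_integralTE => [|x]; last by rewrite lee_fin.
  apply: ge_ereal_sup => _ [h hf <-].
  rewrite -integralT_nnsfun integral_dirac//; last first.
    exact/measurable_EFinP/measurable_funPT.
  by rewrite diracT mul1e; exact: hf.
rewrite fineK// ge0_fin_numE; first exact: le_lt_trans h (ltry _).
by apply: integral_ge0 => x _; rewrite lee_fin.
Qed.

End integrals.

(** * Borel measures: null sets off the support, automatic regularity *)

Section borel_measures.
Context (R : realType) (K : ptopologicalType).

Lemma open_borel (U : set K) : open U -> measurable (U : set (borel K)).
Proof. by move=> oU; apply: sub_sigma_algebra. Qed.

Lemma closed_borel (C : set K) : closed C -> measurable (C : set (borel K)).
Proof.
by move=> /closed_openC/open_borel/measurableC; rewrite setCK.
Qed.

Lemma compact_borel (C : set K) : hausdorff_space K -> compact C ->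
  measurable (C : set (borel K)).
Proof. by move=> hK /(compact_closed hK); exact: closed_borel. Qed.

Lemma continuous_borel_fun (K' : ptopologicalType) (f : K -> K') :
  continuous f -> measurable_fun setT (f : borel K -> borel K').
Proof.
move=> /continuousP cf; apply: (@measurability _ _ (borel K) (borel K') setT f (@open K') erefl).
by move=> _ [U oU <-]; rewrite setTI; apply: open_borel; exact: cf.
Qed.

Lemma continuous_borel_measurable (f : K -> R) : continuous f ->
  measurable_fun setT (f : borel K -> R).
Proof.
move=> /continuousP cf; apply: (measurability _ (RGenOpens.measurableE R)).
move=> _ [_ [a [b ->] <-]]; rewrite setTI; apply: open_borel; apply: cf.
exact: interval_open.
Qed.

Lemma continuous_borel_emeasurable (f : K -> R) : continuous f ->
  measurable_fun setT (fun x : borel K => (f x)%:E).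
Proof. by move=> cf; apply/measurable_EFinP; exact: continuous_borel_measurable. Qed.

(** A point off the support has an open null neighbourhood, and countably many of the resulting null
    sets cover [U]. *)
Lemma open_disjoint_supp_null (mu : {measure set (borel K) -> \bar R}) (U : set K) :
  @second_countable K -> open U -> U `&` supp mu = set0 -> mu U = 0%E.
Proof.
move=> scK oU /disjoints_subset Usupp.
have [|x Ux|A A0 ->] := second_countable_bigcup
    (P := fun A => measurable (A : set (borel K)) /\ mu A = 0%E) (U := U) scK.
- by rewrite measure0; split.
- move: (Usupp _ Ux) => /existsNP[V /not_implyP[oV /not_implyP[Vx /negP]]].
  rewrite -leNgt => muV.
  have mUV : measurable (U `&` V : set (borel K)) by apply: open_borel; exact: openI.
  exists (U `&` V); split => //; last by apply: open_nbhs_nbhs; split; [exact: openI|].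
  split => //; apply/eqP; rewrite eq_le measure_ge0 andbT.
  by apply: le_trans muV; apply: le_measure; rewrite ?inE//; exact: open_borel.
apply/eqP; rewrite eq_le measure_ge0 andbT.
apply: le_trans (measure_sigma_subadditive _ _ _ (subset_refl _)) _.
- by move=> n; exact: (A0 n).1.
- by apply: bigcup_measurable => n _; exact: (A0 n).1.
- by [].
- by rewrite eseries0// => n _ _; exact: (A0 n).2.
Qed.

Lemma measure_bigcup_approx (mu : {measure set (borel K) -> \bar R})
    (A : nat -> set (borel K)) (e : R) : (mu setT < +oo)%E ->
  (forall n, measurable (A n)) -> 0 < e ->
  exists N, (mu (\bigcup_n A n `\` \bigcup_(n < N) A n) < e%:E)%E.
Proof.
move=> muT mA e0; pose F N := \bigcup_n A n `\` \bigcup_(n < N) A n.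
have mF n : measurable (F n).
  by apply: measurableD; apply: bigcup_measurable.
have F0 : \bigcap_n F n = set0.
  apply/seteqP; split => // x Fx; have [[n _ Anx] _] := Fx 0%N I.
  by have [_] := Fx n.+1 I; apply; exists n => //=.
have muoo B : measurable B -> (mu B < +oo)%E.
  by move=> mB; apply: le_lt_trans muT; apply: le_measure; rewrite ?inE.
have : mu \o F @ \oo --> (0 : \bar R).
  rewrite -(measure0 mu) -F0; apply: nonincreasing_cvg_mu => //.
  - exact: muoo.
  - by rewrite F0.
  - move=> m n mn; apply/subsetPset; apply: setDS => x [k /= km Akx].
    by exists k => //=; exact: leq_trans mn.
have eo : nbhs (0 : \bar R) [set x | (x < e%:E)%E].
  by apply: open_nbhs_nbhs; split; [exact: open_ereal_lt_ereal|rewrite /= lte_fin].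
by move=> /(_ _ eo)[N _ /(_ N (leqnn N)) h]; exists N.
Qed.

(** Inner approximation first uses closed sets, since complementation exchanges them with open sets
    and the approximable sets form a sigma-algebra. Open sets belong to it as countable unions of
    compact sets. At the end, sigma-compactness of [K] cuts the closed set down to a compact one. *)
Lemma finite_measure_regular (mu : {measure set (borel K) -> \bar R}) :
  @second_countable K -> hausdorff_space K -> locally_compact [set: K] ->
  (mu setT < +oo)%E -> regular mu.
Proof.
move=> scK hK lcK muT.
have muoo B : measurable B -> (mu B < +oo)%E.
  by move=> mB; apply: le_lt_trans muT; apply: le_measure; rewrite ?inE.
pose G := [set A : set (borel K) | forall e : R, 0 < e ->
  exists C U : set K, [/\ closed C, open U, C `<=` A, A `<=` U &
    (mu (U `\` C) < e%:E)%E]].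
have openE U : open U -> exists2 C : nat -> set K,
    (forall n, compact (C n)) & U = \bigcup_n C n.
  move=> oU; apply: second_countable_bigcup => //; first exact: compact0.
  move=> x Ux; have [|C [cC xC CU]] := locally_compact_regular hK lcK (x := x) (U := U).
    exact: open_nbhs_nbhs.
  by exists C.
have clU (C : nat -> set K) N : (forall n, closed (C n)) ->
    closed (\bigcup_(n < N) C n).
  by move=> cC; rewrite bigcup_mkord; apply: closed_bigsetU => n _; exact: cC.
have sG : sigma_algebra setT G.
  split.
  - move=> e e0; exists set0, set0; split => //; [exact: closed0|exact: open0|].
    by rewrite setD0 measure0 lte_fin.
  - move=> A GA e e0; have [C [U [cC oU CA AU CU]]] := GA e e0.
    exists (~` U), (~` C); split.
    + exact: open_closedC.
    + exact: closed_openC.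
    + by rewrite setTD; exact: subsetC.
    + by rewrite setTD; exact: subsetC.
    + by rewrite setDE setCK setIC -setDE.
  - move=> A GA e e0.
    have ek0 (k : nat) : 0 < e / 2 / (2 ^ k.+1)%:R.
      by rewrite !divr_gt0// ltr0n expn_gt0.
    have /choice[CU CUP] : forall k, exists CU : set K * set K,
        [/\ closed CU.1, open CU.2, CU.1 `<=` A k, A k `<=` CU.2 &
          (mu (CU.2 `\` CU.1) < (e / 2 / (2 ^ k.+1)%:R)%:E)%E].
      by move=> k; have [C [U h]] := GA k _ (ek0 k); exists (C, U).
    have mC k : measurable ((CU k).1 : set (borel K)).
      by apply: closed_borel; case: (CUP k).
    have mU k : measurable ((CU k).2 : set (borel K)).
      by apply: open_borel; case: (CUP k).
    have e20 : 0 < e / 2 by rewrite divr_gt0.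
    have [N hN] := measure_bigcup_approx muT mC e20.
    exists (\bigcup_(n < N) (CU n).1), (\bigcup_n (CU n).2); split.
    + by apply: clU => n; case: (CUP n).
    + by apply: bigcup_open => n _; case: (CUP n).
    + by move=> x [n _ xn]; exists n => //; case: (CUP n) => _ _ + _ _; exact.
    + by move=> x [n _ xn]; exists n => //; case: (CUP n) => _ _ _ + _; exact.
    (* Only a finite union of the closed sets is kept, so the error has two parts: [D] collects the
       individual approximation errors, with geometric weights, and [E] is the tail dropped from the
       union. *)
    + pose D := \bigcup_n ((CU n).2 `\` (CU n).1).
      have mD : measurable (D : set (borel K)).
        by apply: bigcup_measurable => n _; exact: measurableD.
      pose E := \bigcup_n (CU n).1 `\` \bigcup_(n < N) (CU n).1.
      have mE : measurable (E : set (borel K)).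
        by apply: measurableD; apply: bigcup_measurable.
      have Dle : (mu D <= (e / 2)%:E)%E.
        apply: le_trans (measure_sigma_subadditive _ (fun n => measurableD (mU n) (mC n)) mD (@subset_refl _ D)) _.
        apply: (@le_trans _ _ (\sum_(0 <= n <oo) (e / 2 / (2 ^ n.+1)%:R)%:E)%E).
          by apply: lee_nneseries => [n _ _|n _]; [exact: measure_ge0|apply/ltW; case: (CUP n)].
        apply: epsilon_trick0; exact: ltW.
      apply: (@le_lt_trans _ _ (mu D + mu E)%E).
        apply: le_trans (measureU2 mu mD mE); apply: le_measure.
        * rewrite inE; apply: measurableD; first exact: bigcup_measurable.
          exact: bigcup_measurable.
        * by rewrite inE; exact: measurableU.
        * move=> x [[n _ Ux] nx]; have [Cx|nCx] := pselect ((\bigcup_n (CU n).1) x).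
            by right.
          by left; exists n => //; split => // Cx; apply: nCx; exists n.
      rewrite [e]splitr EFinD; apply: lee_ltD => //.
      by rewrite ge0_fin_numE//; exact: muoo.
have GO : measurable `<=` G.
  apply: smallest_sub => // U oU e e0; have [C cC UC] := openE _ oU.
  have mC n : measurable (C n : set (borel K)) by exact: compact_borel.
  have [N hN] := measure_bigcup_approx muT mC e0.
  exists (\bigcup_(n < N) C n), U; split => //.
  - by apply: clU => n; exact: compact_closed.
  - by rewrite UC; apply: bigcup_subset.
  - by rewrite UC.
move=> A mA e e0; have e20 : 0 < e / 2 by rewrite divr_gt0.
have [C [U [cC oU CA AU CU]]] := GO A mA _ e20.
have [Q cQ TQ] := openE _ openT.
have mQ n : measurable (Q n : set (borel K)) by exact: compact_borel.
have [N] := measure_bigcup_approx muT mQ e20; rewrite -TQ => hN.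
have cQN : compact (\bigcup_(n < N) Q n).
  by rewrite bigcup_mkord; apply: bigsetU_compact => n _; exact: cQ.
exists (C `&` \bigcup_(n < N) Q n), U; split => //.
- by rewrite setIC; apply: compact_closedI.
- by move=> x [/CA].
have mC := closed_borel cC; have mU := open_borel oU.
have mQN := compact_borel hK cQN.
move=> B mB BU; rewrite gee0_abs//.
apply: (@le_lt_trans _ _ (mu (U `\` C) + mu (~` \bigcup_(n < N) Q n))%E).
  apply: le_trans (measureU2 mu _ _); [|exact: measurableD|exact: measurableC].
  apply: le_measure; rewrite ?inE//.
    by apply: measurableU; [exact: measurableD|exact: measurableC].
  move=> x /BU[Ux nx]; have [Cx|nCx] := pselect (C x); last by left.
  by right => Qx; apply: nx.
by rewrite [e]splitr EFinD; apply: lteD => //; rewrite -setTD.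
Qed.

End borel_measures.

(** * Convolution and supports *)

Section weak_topology.
Context (R : realType) (K : ptopologicalType).

Lemma weak_cvgP (F : set_system (rprobability R K)) (mu : rprobability R K) :
  Filter F ->
  F --> mu <-> forall f : bounded_continuous R K, weak_ev f @ F --> weak_ev f mu.
Proof.
move=> FF; have := @cvg_sup (rprobability R K) (bounded_continuous R K)
  (fun f => Topological.on (initial_topology (weak_ev f))) F mu FF.
move=> h; split=> [/h Fmu f|Fmu].
  have c := @initial_continuous _ _ (weak_ev f) mu.
  by move=> B /c/(Fmu f).
apply/h => f B /= [_ [[C oC <-] Cmu] CB].
apply: filterS CB _; apply: (Fmu f C); exact: open_nbhs_nbhs.
Qed.

Lemma weak_ev_continuous (f : bounded_continuous R K) :
  continuous (weak_ev f : rprobability R K -> R).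
Proof. by move=> mu; have /weak_cvgP := @cvg_id _ (nbhs mu); exact. Qed.

End weak_topology.

Section probability_integrals.
Context d (T : measurableType d) (R : realType) (P : probability T R).

Lemma probability_integral_lty (f : T -> R) (c : R) :
  (forall x, 0 <= f x <= c) -> (\int[P]_x (f x)%:E < +oo)%E.
Proof.
move=> fc; apply: (@le_lt_trans _ _ (\int[P]_x c%:E)%E).
  by apply: le_lower_integral => x; rewrite lee_fin; case/andP: (fc x).
by rewrite integral_cst// [X in (_ * X)%E](probability_setT P) mule1 ltry.
Qed.

Lemma probability_Rintegral_le (f : T -> R) (c : R) :
  (forall x, 0 <= f x <= c) -> 0 <= \int[P]_x f x <= c.
Proof.
move=> fc; apply/andP; split.
  by apply: Rintegral_ge0 => x _; case/andP: (fc x).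
have -> : c = \int[P]_x c by rewrite Rintegral_cst// [X in fine X](probability_setT P) mulr1.
apply: le_lower_Rintegral => [x|x|]; [by case/andP: (fc x)|by case/andP: (fc x)|].
rewrite integral_cst// [X in (_ * X)%E](probability_setT P) mule1 ltry//.
Qed.

Lemma fine_probability_le1 (A : set T) : measurable A -> 0 <= fine (P A) <= 1.
Proof.
move=> mA; rewrite fine_ge0//= -lee_fin fineK ?fin_num_measure//.
exact: probability_le1.
Qed.

Lemma Rintegral_indic (A : set T) : measurable A -> \int[P]_x \1_A x = fine (P A).
Proof. by move=> mA; rewrite /Rintegral integral_indic// setIT. Qed.

Lemma probability_Rintegral_le_measure (f : T -> R) (A : set T) :
  measurable A -> (forall x, 0 <= f x <= 1) -> (forall x, ~ A x -> f x = 0) ->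
  \int[P]_x f x <= fine (P A).
Proof.
move=> mA f01 fA; rewrite -Rintegral_indic//; apply: le_lower_Rintegral => [x|x|].
- by case/andP: (f01 x).
- rewrite indicE; case: (boolP (x \in A)) => [_|]; first by case/andP: (f01 x).
  by rewrite notin_setE => /fA ->.
- by rewrite integral_indic// setIT -ge0_fin_numE// fin_num_measure.
Qed.

Lemma measure_le_probability_Rintegral (f : T -> R) (A : set T) :
  measurable A -> (forall x, 0 <= f x <= 1) -> (forall x, A x -> f x = 1) ->
  fine (P A) <= \int[P]_x f x.
Proof.
move=> mA f01 fA; rewrite -Rintegral_indic//; apply: le_lower_Rintegral => [x|x|] //.
- rewrite indicE; case: (boolP (x \in A)) => [|_]; last by case/andP: (f01 x).
  by rewrite inE => /fA ->.
- exact: (@probability_integral_lty _ 1).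
Qed.

End probability_integrals.

Section convolution.
Context (R : realType) (K : ptopologicalType) (H : hypergroup R K).
Local Notation p := (hg_point H).
Local Notation dir := (rp_dirac R (hg_hausdorff H)).
Local Notation "mu ** nu" := (rp_mul H mu nu) (at level 40, left associativity).

Lemma hg_eval_continuous (f : K -> R) : continuous f -> bounded_fun f ->
  continuous (fun xy : K * K => hg_eval H f xy.1 xy.2).
Proof.
move=> cf bf xy.
pose F : bounded_continuous R K := exist _ f (conj cf bf).
apply: (@continuous_comp _ _ _ (fun xy => p xy.1 xy.2) (weak_ev F)).
  exact: hg_point_continuous.
exact: weak_ev_continuous.
Qed.

Lemma hg_eval_continuousl (f : K -> R) (y : K) : continuous f -> bounded_fun f ->
  continuous (fun x : K => hg_eval H f x y).
Proof.
move=> cf bf x; apply: (@continuous_comp _ _ _ (fun x => (x, y))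
  (fun xy : K * K => hg_eval H f xy.1 xy.2)).
  by apply: cvg_pair; [exact: cvg_id|exact: cvg_cst].
exact: hg_eval_continuous.
Qed.

Lemma hg_eval_continuousr (f : K -> R) (x : K) : continuous f -> bounded_fun f ->
  continuous (hg_eval H f x).
Proof.
move=> cf bf y; apply: (@continuous_comp _ _ _ (fun y => (x, y))
  (fun xy : K * K => hg_eval H f xy.1 xy.2)).
  by apply: cvg_pair; [exact: cvg_cst|exact: cvg_id].
exact: hg_eval_continuous.
Qed.

Lemma unit_bounded_fun (f : K -> R) : (forall x, 0 <= f x <= 1) -> bounded_fun f.
Proof.
move=> f01; exists 1; split => // M M1 x _ /=; case/andP: (f01 x) => f0 f1.
by rewrite ger0_norm// (le_trans f1)// ltW.
Qed.

Lemma cint_same_measure (c : {charge set (borel K) -> \bar R})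
  (mu : rprobability R K) (f : K -> R) : same_measure c mu ->
  cint c f = \int[mu]_x f x.
Proof.
move=> cmu; rewrite /cint; move: (hahn _) => [[P N] /= PN].
have [[mP Pp] [mN Nn] PNT PN0] := PN.
have N0 A : measurable A -> c (A `&` N) = 0%E.
  move=> mA; apply/eqP; rewrite eq_le; apply/andP; split.
    by apply: Nn; [exact: measurableI | exact: subIsetr].
  by rewrite cmu//; exact: measurableI.
have neg0 A : measurable A -> jordan_neg PN A = 0%E.
  move=> mA; rewrite jordan_negE cjordan_negE /crestr0 mem_set// /crestr.
  by rewrite [X in (- X)%E](N0 A mA) oppe0.
have pos A : measurable A -> jordan_pos PN A = mu A.
  move=> mA; rewrite jordan_posE cjordan_posE /crestr0 mem_set// /crestr.
  have := charge_partition c mA mP mN PNT PN0.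
  by rewrite [X in (_ + X)%E](N0 A mA) adde0 cmu// => ->.
rewrite /Rintegral.
rewrite (@eq_measure_integral _ _ _ setT mu (jordan_pos PN)); last first.
  by move=> A mA _; exact: pos.
rewrite (@eq_measure_integral _ _ _ setT mzero (jordan_neg PN)); last first.
  by move=> A mA _; exact: neg0.
by rewrite integral_measure_zero/= subr0.
Qed.

Lemma Rintegral_same_measure (mu nu : rprobability R K) (f : K -> R) :
  same_measure mu nu -> \int[mu]_x f x = \int[nu]_x f x.
Proof.
move=> munu; rewrite /Rintegral (@eq_measure_integral _ _ _ setT nu mu)//.
by move=> A mA _; exact: munu.
Qed.

Lemma rp_mul_integralE (mu nu : rprobability R K) (A : set (borel K)) :
  measurable A ->
  (mu ** nu) A = (\int[nu]_y (\int[mu]_x fine (p x y A)))%:E.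
Proof.
move=> mA; rewrite rp_mulE// hg_convE// cint_measure.
by congr (_%:E); apply: eq_Rintegral => y _; rewrite cint_measure.
Qed.

Lemma rp_mul_samel (mu mu' nu : rprobability R K) : same_measure mu mu' ->
  same_measure (mu ** nu) (mu' ** nu).
Proof.
move=> mumu A mA; rewrite !rp_mul_integralE//; congr (_%:E).
by apply: eq_Rintegral => y _; exact: Rintegral_same_measure.
Qed.

Lemma hg_conv_samel (c nu : bmeasure R K) (mu : rprobability R K) :
  same_measure c mu -> same_measure (hg_conv H c nu) (hg_conv H (bm_of_rp mu) nu).
Proof.
move=> cmu A mA; rewrite (hg_convE H c nu mA) (hg_convE H (bm_of_rp mu) nu mA).
apply: (congr1 (fun f => (cint nu f)%:E)); apply/funext => y.
by rewrite (cint_same_measure _ cmu) cint_measure.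
Qed.

Lemma hg_conv_samer (mu c : bmeasure R K) (nu : rprobability R K) :
  same_measure c nu -> same_measure (hg_conv H mu c) (hg_conv H mu (bm_of_rp nu)).
Proof.
move=> cnu A mA; rewrite (hg_convE H mu c mA) (hg_convE H mu (bm_of_rp nu) mA).
by apply: (congr1 EFin); rewrite (cint_same_measure _ cnu) cint_measure.
Qed.

Lemma rp_mulA (mu nu lam : rprobability R K) :
  same_measure (mu ** nu ** lam) (mu ** (nu ** lam)).
Proof.
move=> A mA; rewrite (rp_mulE H _ _ mA) (rp_mulE H mu _ mA).
rewrite -(@hg_conv_samel (hg_conv H (bm_of_rp mu) (bm_of_rp nu)) _ (mu ** nu)) //; last first.
  by move=> B mB; rewrite rp_mulE.
rewrite -(@hg_conv_samer _ (hg_conv H (bm_of_rp nu) (bm_of_rp lam)) (nu ** lam)) //; last first.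
  by move=> B mB; rewrite rp_mulE.
exact: hg_convA.
Qed.

Lemma rp_mul_dirac (x y : K) : same_measure (dir x ** dir y) (p x y).
Proof. by move=> A mA; rewrite rp_mulE// hg_pointE. Qed.

Lemma rp_mul_dirac_le (x : K) (nu : rprobability R K) (A : set (borel K))
    (g : K -> R) : measurable A ->
  (forall y, fine (p x y A) <= g y) -> (\int[nu]_y (g y)%:E < +oo)%E ->
  fine ((dir x ** nu) A) <= \int[nu]_y g y.
Proof.
move=> mA pg goo; rewrite rp_mul_integralE//=.
apply: le_lower_Rintegral => // y; last first.
  apply: le_trans (pg y).
  by apply: (@lower_integral_dirac _ (borel K)) => u; apply: fine_ge0.
by apply: Rintegral_ge0 => u _; apply: fine_ge0.
Qed.

(** Without measurability, a Dirac lower integral need not reach the value of its integrand. The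
    function [hg_eval H f] is continuous in its first argument and lies below that integrand, so its
    Dirac integral equals its value and monotonicity gives the bound. *)
Lemma rp_mul_dirac_ge (x : K) (nu : rprobability R K) (A : set (borel K))
    (f : K -> R) : measurable A -> continuous f ->
  (forall z, 0 <= f z <= \1_A z) ->
  \int[nu]_y hg_eval H f x y <= fine ((dir x ** nu) A).
Proof.
move=> mA cf fA.
have f01 z : 0 <= f z <= 1.
  have /andP[-> fz] := fA z; rewrite (le_trans fz)// indicE; by case: (_ \in _).
have bf := unit_bounded_fun f01.
have ev01 u y : 0 <= hg_eval H f u y <= 1 by exact: probability_Rintegral_le.
have evle u y : hg_eval H f u y <= fine (p u y A).
  apply: probability_Rintegral_le_measure => // z nAz; apply/eqP.
  by rewrite eq_le; have := fA z; rewrite indicE memNset// andbC.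
rewrite rp_mul_integralE//=; apply: le_lower_Rintegral => [y|y|].
- by case/andP: (ev01 x y).
- have -> : hg_eval H f x y = \int[dir x]_u hg_eval H f u y.
    rewrite /Rintegral integral_dirac//; last first.
      by apply: continuous_borel_emeasurable; exact: hg_eval_continuousl.
    by rewrite diracT mul1e.
  apply: le_lower_Rintegral => [u|u|] //.
  + by case/andP: (ev01 u y).
  + apply: (@probability_integral_lty _ _ _ _ _ 1) => u.
    exact: fine_probability_le1.
- apply: (@probability_integral_lty _ _ _ _ _ 1) => y.
  apply: probability_Rintegral_le => u; exact: fine_probability_le1.
Qed.
Lemma supp_same_measure (mu nu : set (borel K) -> \bar R) :
  same_measure mu nu -> supp mu = supp nu.
Proof.
move=> munu; apply/seteqP; split => x sx U oU Ux; have := sx U oU Ux.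
  by rewrite munu//; exact: open_borel.
by rewrite munu//; exact: open_borel.
Qed.

Lemma hg_point_inv (x y : K) (A : set (borel K)) : measurable A ->
  p x y (hg_inv H @^-1` A) = p (hg_inv H y) (hg_inv H x) A.
Proof.
move=> mA; rewrite -(hg_pointE H _ _ mA) -(hg_invM H _ _ mA) /pushforward hg_pointE//.
rewrite -[X in measurable X]setTI.
by apply: (continuous_borel_fun (@hg_inv_continuous _ _ H)).
Qed.

Lemma hg_eval_inv (f : K -> R) (x y : K) : continuous f -> (forall z, 0 <= f z) ->
  hg_eval H f (hg_inv H y) (hg_inv H x) = hg_eval H (f \o hg_inv H) x y.
Proof.
move=> cf f0; rewrite /hg_eval /Rintegral; congr fine.
have mi := continuous_borel_fun (@hg_inv_continuous _ _ H).
rewrite (eq_measure_integral (pushforward (p x y) (hg_inv H : borel K -> borel K)))//.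
  rewrite ge0_integral_pushforward//; first exact: continuous_borel_emeasurable.
  by move=> z _; rewrite lee_fin.
by move=> A mA _; exact: (esym (hg_point_inv x y mA)).
Qed.

Lemma supp_inv (x y c : K) : supp (p x y) c ->
  supp (p (hg_inv H y) (hg_inv H x)) (hg_inv H c).
Proof.
move=> sc U oU Uc; rewrite -hg_point_inv; last exact: open_borel.
apply: sc => //; apply: open_comp => // z _; exact: hg_inv_continuous.
Qed.

Lemma hg_unit_suppP (x y : K) : supp (p x y) (hg_unit H) <-> x = hg_inv H y.
Proof.
rewrite -hg_unit_supp; suff -> : supp (p x y) =
  supp (hg_conv H (hg_dirac H x) (hg_dirac H y)) by [].
by apply: supp_same_measure => A mA; rewrite hg_pointE.
Qed.

Lemma supp_compact (x y : K) : compact (supp (p x y)).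
Proof. by rewrite -hg_suppE; exact: nc_compact. Qed.

Hypothesis scK : @second_countable K.

Lemma supp_setC_null (x y : K) : p x y (~` supp (p x y)) = 0%E.
Proof.
apply: open_disjoint_supp_null => //; last by rewrite setICl.
apply: closed_openC; apply: compact_closed; last exact: supp_compact.
exact: (hg_hausdorff H).
Qed.

(** Upper semicontinuity of the support: in the Michael set given by [setT] and [V], the meeting
    condition holds by nonemptiness alone, which leaves containment in [V]. *)
Lemma supp_near (x y : K) (V : set K) : open V -> supp (p x y) `<=` V ->
  \forall uv \near (x, y), supp (p uv.1 uv.2) `<=` V.
Proof.
move=> oV sV; pose S := [set A : ncompact K | nc_set A `&` setT !=set0 /\ nc_set A `<=` V].
have oS : open S.
  exists [set S]; last by rewrite bigcup_set1.
  by move=> _ ->; apply: (finI_from1 _ (i := (setT, V))); split => //; exact: openT.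
have : nbhs (hg_supp H x y) S.
  apply: open_nbhs_nbhs; split => //; split; last by rewrite hg_suppE.
  by have [c sc] := nc_nonempty (hg_supp H x y); exists c.
move=> /(@hg_supp_continuous _ _ H (x, y)) h.
have {}h : \forall uv \near (x, y), S (hg_supp H uv.1 uv.2) by [].
by apply: filterS h => uv [_]; rewrite hg_suppE.
Qed.

Lemma supp_Rintegral_gt0 (mu : rprobability R K) (f : K -> R) (c : K) :
  continuous f -> (forall x, 0 <= f x <= 1) -> supp mu c -> 0 < f c ->
  0 < \int[mu]_x f x.
Proof.
move=> cf f01 sc fc0; pose U := f @^-1` [set r | f c / 2 < r].
have oU : open U by apply: open_comp => [x _|]; [exact: cf|exact: open_gt].
have muU : (0 < mu U)%E by apply: sc => //; rewrite /U /=; lra.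
have mU := open_borel oU.
apply: (@lt_le_trans _ _ (\int[mu]_x (f c / 2 * \1_U x))).
  have fin : mu U \is a fin_num by rewrite fin_num_measure.
  rewrite RintegralZl//; last first.
    by apply: integrable_indic => //; rewrite -ge0_fin_numE.
  rewrite /Rintegral integral_indic// setIT mulr_gt0 ?divr_gt0//.
  by rewrite fine_gt0// muU -ge0_fin_numE.
apply: le_lower_Rintegral => [x|x|].
- by rewrite mulr_ge0// divr_ge0// ltW.
- rewrite indicE; case: (boolP (x \in U)) => xU; last by rewrite mulr0; case/andP: (f01 x).
  by rewrite mulr1; move: xU; rewrite inE => /ltW.
- exact: (@probability_integral_lty _ _ _ _ _ 1).
Qed.

(* The mass that delta_(c^-) * (delta_y * delta_z) has near the unit is positive
   because c is in {y}*{z}; by associativity some w in {c^-}*{y} has the unit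
   in {w}*{z}, so that w = z^-. *)
Lemma supp_conv_unit (y z c : K) : supp (p y z) c ->
  supp (p (hg_inv H c) y) (hg_inv H z).
Proof.
have hK := hg_hausdorff H; have lcK := hg_locally_compact H.
move=> scyz; apply: contrapT => nS; pose e := hg_unit H.
set S := supp (p (hg_inv H c) y) in nS.
(* Since z^- is assumed not to lie in [S], no {w}*{z} with w in [S] contains the unit. Upper
   semicontinuity and compactness of [S] give one neighbourhood of the unit that is null for all
   these products. *)
have [U [oU Ue SU]] : exists U : set K,
    [/\ open U, U e & forall w, S w -> p w z U = 0%E].
  apply: (compact_ideal (P := fun A => exists U : set K,
    [/\ open U, U e & forall w, A w -> p w z U = 0%E]) (@supp_compact (hg_inv H c) y)).
  - by exists setT; split => //; exact: openT.
  - move=> A B [U [oU Ue AU]] [V [oV Ve BV]]; exists (U `&` V).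
    have mU := open_borel oU; have mV := open_borel oV.
    split => [||w []]; [exact: openI|by []|move=> /AU|move=> /BV] => w0.
      by apply: (subset_measure0 _ _ _ w0) => //; exact: measurableI.
    by apply: (subset_measure0 _ _ _ w0) => //; exact: measurableI.
  - by move=> A B AB [U [oU Ue BU]]; exists U; split => // w /AB /BU.
  - move=> w Sw; have nwe : ~ supp (p w z) e.
      by move=> /hg_unit_suppP wz; apply: nS; rewrite -wz.
    have [|C [cC eC Csupp]] := locally_compact_regular hK lcK (x := e) (U := ~` supp (p w z)).
      apply: open_nbhs_nbhs; split => //; apply: closed_openC.
      by apply: compact_closed => //; exact: supp_compact.
    have oC : open (~` C) by by apply: closed_openC; exact: compact_closed.
    have /(supp_near oC) [[/= N M] [Nw Mz] NM] : supp (p w z) `<=` ~` C by apply: subsetCr.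
    exists N => //; exists (interior C); split => //; first exact: open_interior.
    move=> w' Nw'; apply: open_disjoint_supp_null => //; first exact: open_interior.
    apply/disjoints_subset => x /interior_subset Cx sx.
    by have /(_ x sx) := NM (w', z) (conj Nw' (nbhs_singleton Mz)).
have [|f [cf f01 fe fU _]] := compact_bump R hK lcK (@compact_set1 _ e) oU.
  by move=> _ ->.
have bf := unit_bounded_fun f01.
have mU := open_borel oU.
have : 0 < fine ((dir (hg_inv H c) ** (dir y ** dir z)) U).
  apply: lt_le_trans (@rp_mul_dirac_ge _ _ _ f _ _ _) => //; last first.
    move=> x; rewrite indicE; case: (boolP (x \in U)) => [_//|].
    rewrite notin_setE => nUx; case/andP: (f01 x) => -> _ /=.
    by have [->//|/fU] := eqVneq (f x) 0.
  rewrite (Rintegral_same_measure _ (@rp_mul_dirac y z)).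
  apply: (supp_Rintegral_gt0 _ _ scyz).
  - exact: hg_eval_continuousr.
  - by move=> u; exact: probability_Rintegral_le.
  - apply: (supp_Rintegral_gt0 cf f01 (c := e)); last by rewrite fe.
    exact/hg_unit_suppP.
(* Grouped the other way, the mass of [U] is at most the mass of the complement of [S] under
   [p (hg_inv H c) y], which is 0. *)
rewrite -rp_mulA// (rp_mul_samel _ (@rp_mul_dirac _ _))// rp_mul_integralE//= ltNge => /negP; apply.
apply: le_trans (@lower_integral_dirac _ (borel K) _ z _ _) _.
  by move=> u; apply: Rintegral_ge0 => w _; exact: fine_ge0.
have mS : measurable (S : set (borel K)).
  by apply: compact_borel => //; exact: supp_compact.
have mSC := measurableC mS.
apply: (@le_trans _ _ (fine (p (hg_inv H c) y (~` S)))).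
  apply: probability_Rintegral_le_measure => // w; first exact: fine_probability_le1.
  by move=> /contrapT /SU ->.
by rewrite supp_setC_null.
Qed.

Lemma supp_convl (y z c : K) : supp (p y z) c -> supp (p (hg_inv H y) c) z.
Proof. by move=> /supp_conv_unit/supp_inv; rewrite !hg_invK. Qed.

Lemma supp_convr (y z c : K) : supp (p y z) c -> supp (p c (hg_inv H z)) y.
Proof. by move=> /supp_inv/supp_conv_unit; rewrite !hg_invK. Qed.

Lemma supp_prod_compact (C L : set K) : compact C -> compact L ->
  exists2 W : set K, compact W &
    forall c l, C c -> L l -> supp (p c l) `<=` W.
Proof.
move=> cC cL; have lcK := hg_locally_compact H.
have [W cW CLW] : exists2 W : set K, compact W &
    forall uv, (C `*` L) uv -> supp (p uv.1 uv.2) `<=` W.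
  apply: (compact_ideal (P := fun A => exists2 W : set K, compact W &
    forall uv, A uv -> supp (p uv.1 uv.2) `<=` W) (compact_setX cC cL)).
  - by exists set0 => //; exact: compact0.
  - move=> A B [V cV AV] [W cW BW]; exists (V `|` W); first exact: compactU.
    by move=> uv [/AV|/BW] h x /h; [left|right].
  - by move=> A B AB [W cW BW]; exists W => // uv /AB/BW.
  - move=> [u v] _; have [V [W [oV cW _ sV VW]]] := compact_sub_nbhs lcK (@supp_compact u v).
    exists [set uv | supp (p uv.1 uv.2) `<=` V]; first exact: supp_near.
    by exists W => // uv /= h x /h/VW.
by exists W => // c l Cc Ll; exact: (CLW (c, l)).
Qed.

(** * Haar measure and spreading *)

Section haar.
Variable m : {measure set (borel K) -> \bar R}.
Hypothesis haar_m : right_haar H m.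

Lemma compact_preimage_inv (C : set K) : compact C -> compact (hg_inv H @^-1` C).
Proof.
move=> cC; have -> : hg_inv H @^-1` C = hg_inv H @` C.
  apply/seteqP; split => x /=; last by move=> [y Cy <-]; rewrite hg_invK.
  by move=> Cx; exists (hg_inv H x) => //; rewrite hg_invK.
apply: continuous_compact => //; apply: continuous_subspaceT => x.
exact: hg_inv_continuous.
Qed.

(** The involution reverses products, so the image of [m] under it is invariant on the other side. A
    compact set of positive mass comes from inner regularity on the whole space. *)
Lemma left_haar_exists : exists m' : {measure set (borel K) -> \bar R},
  [/\ forall C : set K, compact C -> (m' C < +oo)%E,
      exists2 C : set K, compact C & (0 < m' C)%E &
      forall (x : K) (f : K -> R), continuous f -> (forall z, 0 <= f z <= 1) ->
        compact (closure [set y | f y != 0]) ->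
        (\int[m']_y (hg_eval H f x y)%:E = \int[m']_y (f y)%:E)%E].
Proof.
have [[mfin _ minner] m0 minv] := haar_m.
have ci := @hg_inv_continuous _ _ H.
have mi : measurable_fun setT (hg_inv H : borel K -> borel K).
  exact: continuous_borel_fun.
pose m' : {measure set (borel K) -> \bar R} :=
  measure_function_pushforward__canonical__measure_function_Measure m mi.
have m'E (g : K -> R) : continuous g -> (forall x, 0 <= g x) ->
    (\int[m']_y (g y)%:E = \int[m]_y (g (hg_inv H y))%:E)%E.
  move=> cg g0; rewrite ge0_integral_pushforward//.
  - exact: continuous_borel_emeasurable.
  - by move=> z _; rewrite lee_fin.
exists m'; split.
- by move=> C cC; apply: mfin; exact: compact_preimage_inv.
- suff [C cC mC] : exists2 C : set K, compact C & (0 < m C)%E.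
    exists (hg_inv H @^-1` C); first exact: compact_preimage_inv.
    rewrite /m' /= /pushforward [X in m X](_ : _ = C)//.
    by apply/seteqP; split => x /=; rewrite hg_invK.
  apply: contrapT => nC; apply: m0; rewrite minner; last exact: openT.
  apply/eqP; rewrite eq_le; apply/andP; split.
    apply: ge_ereal_sup => _ [C [cC _] <-]; rewrite leNgt; apply/negP => mC.
    by apply: nC; exists C.
  by apply: ereal_sup_ubound; exists set0; [split => //; exact: compact0|exact: measure0].
- move=> x f cf f01 cS.
  have bf := unit_bounded_fun f01.
  rewrite !m'E//; last 3 first.
  + by move=> y; case/andP: (f01 y).
  + exact: hg_eval_continuousr.
  + by move=> y; case/andP: (@probability_Rintegral_le _ _ _ (p x y) f 1 f01).
  rewrite -(minv (hg_inv H x) (f \o hg_inv H)).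
  + apply: eq_integral => y _; rewrite -hg_eval_inv ?hg_invK//.
    by move=> z; case/andP: (f01 z).
  + by move=> y; apply: continuous_comp; [exact: ci|exact: cf].
  + apply: (subclosed_compact _ (compact_preimage_inv cS)); first exact: closed_closure.
    have cl : closed (hg_inv H @^-1` closure [set y | f y != 0]).
      by apply: closed_comp => [y _|]; [exact: ci|exact: closed_closure].
    move/closure_id : cl => ->; apply: closureS => y /= fy.
    exact: subset_closure.
Qed.

End haar.

Lemma hg_eval_neq0 (f : K -> R) (x y : K) : (forall z, 0 <= f z <= 1) ->
  hg_eval H f x y != 0 -> exists2 c, supp (p x y) c & f c != 0.
Proof.
move=> f01; apply: contra_neqP => h.
have cS := @supp_compact x y; have hK := hg_hausdorff H.
have mS := compact_borel hK cS.
have f0 z : supp (p x y) z -> f z = 0.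
  by move=> sz; apply: contrapT => /eqP fz; apply: h; exists z.
apply/eqP; rewrite eq_le; apply/andP; split; last first.
  by case/andP: (@probability_Rintegral_le _ _ _ (p x y) f 1 f01).
have mSC := measurableC mS.
apply: (@le_trans _ _ (fine (p x y (~` supp (p x y))))).
  by apply: probability_Rintegral_le_measure => // z /contrapT /f0.
by rewrite supp_setC_null.
Qed.

Section left_haar.
Variable m : {measure set (borel K) -> \bar R}.
Hypothesis mfin : forall C : set K, compact C -> (m C < +oo)%E.
Hypothesis mpos : exists2 C : set K, compact C & (0 < m C)%E.
Hypothesis minv : forall (x : K) (f : K -> R), continuous f ->
  (forall z, 0 <= f z <= 1) -> compact (closure [set y | f y != 0]) ->
  (\int[m]_y (hg_eval H f x y)%:E = \int[m]_y (f y)%:E)%E.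

Lemma compact_support_integral_lty (f : K -> R) : (forall z, 0 <= f z <= 1) ->
  compact (closure [set y | f y != 0]) -> (\int[m]_y (f y)%:E < +oo)%E.
Proof.
move=> f01 cS; apply: le_lt_trans (mfin cS).
have mS := compact_borel (hg_hausdorff H) cS.
rewrite -[X in (_ <= m X)%E]setIT -integral_indic//.
apply: le_lower_integral => z; rewrite lee_fin; first by case/andP: (f01 z).
rewrite indicE; case: (boolP (z \in _)) => [_|]; first by case/andP: (f01 z).
rewrite notin_setE => nz; have [->//|fz] := eqVneq (f z) 0.
by exfalso; apply: nz; exact: subset_closure.
Qed.

(* D' adds to D a translate of the support of a bump function f, chosen disjoint
   from D, and a is the integral of f. *)
Lemma left_haar_step : ~ compact [set: K] ->
  exists2 a : R, 0 < a & forall D : set K, compact D ->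
    exists2 D' : set K, compact D' & (m D + a%:E <= m D')%E.
Proof.
move=> ncK; have hK := hg_hausdorff H.
have [C cC mC] := mpos.
have [f [cf f01 fC _ cS]] := compact_bump R hK (hg_locally_compact H) cC openT (@subsetT _ C).
set S := closure _ in cS.
have fS z : f z != 0 -> S z by move=> fz; exact: subset_closure.
have If := compact_support_integral_lty f01 cS.
have If0 : (0 < \int[m]_y (f y)%:E)%E.
  apply: lt_le_trans mC _; have mC := compact_borel hK cC.
  rewrite -[X in (m X <= _)%E]setIT -integral_indic//.
  apply: le_lower_integral => z; rewrite lee_fin// indicE.
  case: (boolP (z \in C)) => [|_]; first by rewrite inE => /fC ->.
  by case/andP: (f01 z).
have Ifin : (\int[m]_y (f y)%:E)%E \is a fin_num by rewrite ge0_fin_numE// ltW.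
exists (fine (\int[m]_y (f y)%:E)%E); first by rewrite fine_gt0// If0.
move=> D cD; rewrite fineK//.
(* [E] contains all products of [D] with the inverse of [S]. A point [u] off [E] then moves the bump
   off [D]: if [y] in [D] were in the translated support, then [u] would lie in {y}*{c^-} for some c
   in [S]. *)
have [E cE DSE] := supp_prod_compact cD (compact_preimage_inv cS).
have [u nEu] : exists u, ~ E u.
  apply: contrapT => nu; apply: ncK; apply: (subclosed_compact _ cE).
    exact: closedT.
  by move=> x _; apply: contrapT => nEx; apply: nu; exists x.
have [F cF uSF] := supp_prod_compact (@compact_set1 _ u) cS.
have FD y : hg_eval H f (hg_inv H u) y != 0 -> F y /\ ~ D y.
  move=> /(hg_eval_neq0 f01)[c sc /fS Sc]; split.
    by apply: (uSF u c) => //; have := supp_convl sc; rewrite hg_invK.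
  move=> Dy; apply: nEu; apply: (DSE y (hg_inv H c)) => //.
    by rewrite /preimage /= hg_invK.
  by have := supp_inv (supp_convr sc); rewrite !hg_invK.
have mD := compact_borel hK cD; have mF := compact_borel hK cF.
exists (D `|` F); first exact: compactU.
have -> : D `|` F = D `|` (F `\` D) by rewrite setUDr setDv setD0.
rewrite measureU//; [|exact: measurableD|by rewrite setIDA setIC -setIDA setDv setI0].
rewrite leeD2l// -(minv (hg_inv H u) cf f01 cS).
have mFD := measurableD mF mD.
rewrite -[X in (_ <= m X)%E]setIT -integral_indic//.
have ev01 y := @probability_Rintegral_le _ _ _ (p (hg_inv H u) y) f 1 f01.
apply: le_lower_integral => y; rewrite lee_fin; first by case/andP: (ev01 y).
rewrite indicE; case: (boolP (y \in _)) => [_|]; first by case/andP: (ev01 y).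
rewrite notin_setE => nFD; have [->//|/FD h] := eqVneq (hg_eval H f (hg_inv H u) y) 0.
by exfalso; apply: nFD.
Qed.

Lemma left_haar_unbounded : ~ compact [set: K] ->
  forall M : R, exists2 D : set K, compact D & (M%:E <= m D)%E.
Proof.
move=> ncK M; have [a a0 step] := left_haar_step ncK.
have h (n : nat) : exists2 D : set K, compact D & ((n%:R * a)%:E <= m D)%E.
  elim: n => [|n [D cD nD]].
    by exists set0; [exact: compact0|rewrite mul0r measure0].
  have [D' cD' DD'] := step D cD; exists D' => //; apply: le_trans DD'.
  by rewrite -natr1 mulrDl mul1r EFinD leeD.
have [D cD nD] := h (Num.bound (M / a)); exists D => //; apply: le_trans nD.
rewrite lee_fin -ler_pdivrMr//.
have [M0|M0] := leP 0 (M / a); last by rewrite (le_trans (ltW M0)).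
by rewrite ltW// archi_boundP.
Qed.

Lemma normalized_restriction (D : set K) : compact D -> (0 < m D)%E ->
  exists mu : rprobability R K, forall A : set (borel K), measurable A ->
    (mu A <= (fine (m D))^-1%:E * m A)%E.
Proof.
move=> cD mD0; have mD := compact_borel (hg_hausdorff H) cD.
(* The Dirac measure is only the default of [mnormalize] for mass 0 or infinity, both excluded
   here. *)
pose P := mnormalize (mrestr m mD) (dirac (hg_unit H : borel K)).
have mDfin : m D \is a fin_num by rewrite ge0_fin_numE//; exact: mfin.
have PE A : measurable A -> P A = ((fine (m D))^-1%:E * m (A `&` D))%E.
  move=> mA; have eT : mrestr m mD setT = m D by rewrite /mrestr setTI.
  rewrite /P /mnormalize /= eT gt_eqF//= lt_eqF; last by rewrite ltey_eq mDfin.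
  by rewrite muleC.
have regP : regular P.
  apply: (finite_measure_regular scK (hg_hausdorff H) (hg_locally_compact H)).
  by rewrite [X in (X < _)%E](probability_setT P) ltry.
exists (RProbability regP) => A mA; rewrite [X in (X <= _)%E](PE A mA).
rewrite lee_wpmul2l//.
by apply: le_measure; rewrite ?inE//; exact: measurableI.
Qed.

(** A compact set [L] carries [nu] up to eps/2, and [W] contains the products of [C] with the
    inverse of [L]. For w off [W] and z in [L] the set [C] is null under [p w z], so its mass is at
    most eps/2 plus the mass of [W] under delta_x * mu. The latter is at most the mu-integral of a
    translated bump, hence at most b / m(D) by domination and left invariance. *)
Lemma spread (C : set K) (nu : rprobability R K) (eps : R) :
  ~ compact [set: K] -> compact C -> 0 < eps ->
  exists mu : rprobability R K, forall x,
    fine ((dir x ** (mu ** nu)) C) <= eps.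
Proof.
move=> ncK cC eps0; have hK := hg_hausdorff H; have lcK := hg_locally_compact H.
have e20 : 0 < eps / 2 by rewrite divr_gt0.
have [L [U [cL _ _ TU small]]] := rp_regular nu measurableT e20.
have mL := compact_borel hK cL; have mC := compact_borel hK cC.
have nuL : fine (nu (~` L)) <= eps / 2.
  rewrite -lee_fin fineK ?fin_num_measure//; last exact: measurableC.
  apply/ltW; rewrite -[X in (X < _)%E]gee0_abs//; apply: small; first exact: measurableC.
  by move=> x Lx; split => //; exact: TU.
have [W cW CLW] := supp_prod_compact cC (compact_preimage_inv cL).
have mW := compact_borel hK cW.
have pC w z : L z -> ~ W w -> p w z C = 0%E.
  move=> Lz nWw; apply/eqP; rewrite eq_le measure_ge0 andbT.
  have cS := @supp_compact w z; have mS := compact_borel hK cS.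
  rewrite -(supp_setC_null w z); apply: le_measure; rewrite ?inE//; first exact: measurableC.
  move=> c Cc /supp_convr sc; apply: nWw; apply: (CLW c (hg_inv H z)) => //.
  by rewrite /preimage /= hg_invK.
have [f [cf f01 fW _ cS]] := compact_bump R hK lcK cW openT (@subsetT _ W).
have If := compact_support_integral_lty f01 cS.
have If0 : (0 <= \int[m]_y (f y)%:E)%E.
  by apply: integral_ge0 => y _; rewrite lee_fin; case/andP: (f01 y).
have Ifin : (\int[m]_y (f y)%:E)%E \is a fin_num by rewrite ge0_fin_numE.
pose b := fine (\int[m]_y (f y)%:E)%E.
have b0 : 0 <= b by exact: fine_ge0.
(* The first summand makes b / m(D) at most eps/2; the added 1 keeps m(D) positive even if b = 0. *)
have [D cD mD] := left_haar_unbounded ncK (b / (eps / 2) + 1).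
have mDfin : m D \is a fin_num by rewrite ge0_fin_numE//; exact: mfin.
have bD : b / (eps / 2) + 1 <= fine (m D) by rewrite -lee_fin fineK.
have b20 : 0 <= b / (eps / 2) by rewrite divr_ge0// ltW.
have mD0 : 0 < fine (m D) by rewrite (lt_le_trans _ bD)// ltr_wpDl.
have [|mu muD] := normalized_restriction cD; first by rewrite -(fineK mDfin) lte_fin.
exists mu => x.
have bf := unit_bounded_fun f01.
have ev01 y := @probability_Rintegral_le _ _ _ (p x y) f 1 f01.
have cev : continuous (hg_eval H f x) by exact: hg_eval_continuousr.
have xmuW : fine ((dir x ** mu) W) <= eps / 2.
  apply: (@le_trans _ _ (\int[mu]_y hg_eval H f x y)).
    apply: rp_mul_dirac_le => //.
      by move=> y; exact: measure_le_probability_Rintegral.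
    exact: (@probability_integral_lty _ _ _ _ _ 1).
  have q0 : 0 <= (fine (m D))^-1 by rewrite invr_ge0 ltW.
  have h : (\int[mu]_y (hg_eval H f x y)%:E <= ((fine (m D))^-1 * b)%:E)%E.
    rewrite EFinM fineK// -(minv x cf f01 cS).
    rewrite -(@ge0_integral_mscale _ _ _ m setT _ (NngNum q0))//.
    - apply: ge0_le_measure_integral => //.
      + by move=> y; rewrite lee_fin; case/andP: (ev01 y).
      + exact: continuous_borel_emeasurable.
    - exact: continuous_borel_emeasurable.
    - by move=> y _; rewrite lee_fin; case/andP: (ev01 y).
  rewrite -lee_fin /Rintegral fineK; last first.
    rewrite ge0_fin_numE ?(le_lt_trans h) ?ltry//.
    by apply: integral_ge0 => y _; rewrite lee_fin; case/andP: (ev01 y).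
  apply: le_trans h _; rewrite lee_fin mulrC ler_pdivrMr// mulrC.
  by rewrite -ler_pdivrMr// (le_trans _ bD)// lerDl.
rewrite -rp_mulA// rp_mul_integralE//=.
have in01 z := @probability_Rintegral_le _ _ _ (dir x ** mu) (fun w => fine (p w z C)) 1
  (fun w => fine_probability_le1 (p w z) mC).
have mLC := measurableC mL.
have gint : nu.-integrable setT (EFin \o (\1_(~` L) : K -> R)).
  by apply: integrable_indic => //; rewrite -ge0_fin_numE// fin_num_measure.
have cint : nu.-integrable setT (EFin \o cst (eps / 2)).
  by apply: finite_measure_integrable_cst.
apply: (@le_trans _ _ (\int[nu]_z (\1_(~` L) z + eps / 2))).
  apply: le_lower_Rintegral => [z|z|].
  - by case/andP: (in01 z).
  - rewrite indicE; case: (boolP (z \in _)) => [_|].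
      by case/andP: (in01 z) => _ h; rewrite (le_trans h)// lerDl ltW.
    rewrite notin_setE => /contrapT Lz; rewrite add0r.
    apply: le_trans xmuW.
    apply: probability_Rintegral_le_measure => // [w|w /(pC _ _ Lz) ->//].
    exact: fine_probability_le1.
  - apply: (@probability_integral_lty _ _ _ _ _ (1 + eps / 2)) => z.
    rewrite lerD2r indicE; apply/andP; split; last by case: (_ \in _).
    by apply: addr_ge0; [case: (_ \in _)|exact: ltW].
rewrite RintegralD// Rintegral_cst// [X in fine X](probability_setT nu) mulr1.
rewrite [X in X + _]/Rintegral integral_indic// setIT.
by rewrite [leRHS]splitr lerD2r.
Qed.

End left_haar.

(** * Compact exhaustion and escape of mass *)

Lemma compact_exhaustion : exists C : nat -> set K,
  [/\ forall n, compact (C n), forall m n, (m <= n)%N -> C m `<=` C n &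
      forall A, compact A -> exists n, A `<=` C n].
Proof.
have lcK := hg_locally_compact H.
have [|x _|A AP TA] := second_countable_bigcup
    (P := fun A : set K => open A /\ exists2 W : set K, compact W & A `<=` W)
    (U := setT) scK.
- by split; [exact: open0|exists set0 => //; exact: compact0].
- have [W] := lcK x I; rewrite withinET => xW [cW _].
  exists (interior W); split => //; last exact: nbhs_interior.
  by split; [exact: open_interior|exists W => //; exact: interior_subset].
have /choice[W WP] : forall n, exists W : set K, compact W /\ A n `<=` W.
  by move=> n; have [_ [W cW AW]] := AP n; exists W.
exists (fun n => \bigcup_(i < n) W i); split.
- by move=> n; rewrite bigcup_mkord; apply: bigsetU_compact => i _; case: (WP i).
- by move=> m n mn x [i /= im Wx]; exists i => //=; exact: leq_trans mn.
- move=> B cB; apply: (compact_ideal (P := fun A => exists n, A `<=` \bigcup_(i < n) W i) cB).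
  + by exists 0%N.
  + move=> B1 B2 [m Bm] [n Bn]; exists (maxn m n) => x [/Bm|/Bn] [i /= im Wx];
      by exists i => //=; rewrite leq_max im ?orbT.
  + by move=> B1 B2 B12 [n Bn]; exists n; exact: subset_trans Bn.
  + move=> x _; have : setT x by [].
    rewrite TA => -[n _ Anx]; exists (A n).
      by apply: open_nbhs_nbhs; split => //; case: (AP n).
    by exists n.+1 => y Ay; exists n => //=; case: (WP n) => _; exact.
Qed.

Lemma normed_convergence_property_compact :
  (exists m : {measure set (borel K) -> \bar R}, right_haar H m) ->
  normed_convergence_property H -> compact [set: K].
Proof.
move=> [m0 /left_haar_exists[m [mfin mpos minv]]] ncp; apply: contrapT => ncK.
have hK := hg_hausdorff H; have lcK := hg_locally_compact H.
have [C [cC C_nd C_exh]] := compact_exhaustion.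
(* The bound is uniform in [x], so the next factor depends only on the product reached so far; the
   recursion [s] can be run before the translates are known. *)
have /choice[G GP] : forall n, exists G : rprobability R K -> rprobability R K,
    forall nu x, fine ((dir x ** (G nu ** nu)) (C n)) <= n.+1%:R^-1.
  move=> n; have /choice[G GP] : forall nu, exists mu : rprobability R K,
      forall x, fine ((dir x ** (mu ** nu)) (C n)) <= n.+1%:R^-1.
    by move=> nu; apply: (spread mfin mpos minv).
  by exists G.
pose s := fix s n : rprobability R K * rprobability R K :=
  if n is k.+1 then (G k.+1 (s k).2, G k.+1 (s k).2 ** (s k).2)
  else (dir (hg_unit H), dir (hg_unit H)).
pose mu n := (s n).1.
have prodE n : rp_prod H mu n = (s n).2 by elim: n => //= n ->.
have [x [B rB [cB _]]] := ncp mu.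
pose nu n := dir (x n) ** rp_prod H mu n.
have nuC n : fine (nu n.+1 (C n.+1)) <= n.+2%:R^-1.
  by rewrite /nu prodE /=; exact: GP.
have nuB : (nu @ \oo) B by exists 0%N => // n _; apply: rB; exists n.
have [lam [_ clam]] := cB (nu @ \oo) _ nuB.
have h2 : 0 < 2^-1 :> R by rewrite invr_gt0.
have [L [U [cL _ _ TU small]]] := rp_regular lam measurableT h2.
have mL := compact_borel hK cL.
have lamL : 2^-1 < fine (lam L).
  have : (lam (~` L) < (2^-1)%:E)%E.
    rewrite -[X in (X < _)%E]gee0_abs//; apply: small; first exact: measurableC.
    by move=> y Ly; split => //; exact: TU.
  rewrite -lte_fin fineK ?fin_num_measure// [X in (X < _)%E -> _](probability_setC lam mL).
  have /fineK <- : lam L \is a fin_num by exact: fin_num_measure.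
  rewrite -EFinB !lte_fin; lra.
(* The integral of this bump against [lam] exceeds 1/2, an open condition in the weak topology.
   Against [nu n] it is at most the mass of [C n] once [C n] contains the support. *)
have [f [cf f01 fL _ cS]] := compact_bump R hK lcK cL openT (@subsetT _ L).
have bf := unit_bounded_fun f01.
pose F : bounded_continuous R K := exist _ f (conj cf bf).
have [N SN] := C_exh _ cS.
have lamf : 2^-1 < weak_ev F lam.
  by apply: lt_le_trans lamL _; exact: measure_le_probability_Rintegral.
have nF : nbhs lam (weak_ev F @^-1` [set r | 2^-1 < r]).
  apply: open_nbhs_nbhs; split => //; apply: open_comp; last exact: open_gt.
  by move=> r _; exact: weak_ev_continuous.
(* Index 0 is excluded: the initial Dirac factor is not spread out, and 1/(n+1) is at most 1/2 only
   from n = 1 on. *)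
have nuN : (nu @ \oo) (nu @` [set n | (maxn N 1 <= n)%N]).
  by exists (maxn N 1) => // n /= Nn; exists n.
have [_ [[n /= Nn <-] ]] := clam _ _ nuN nF.
apply/negP; rewrite -leNgt.
case: n Nn => [|n]; first by rewrite geq_max andbF.
rewrite geq_max => /andP[Nn _]; have mC := compact_borel hK (cC n.+1).
apply: (@le_trans _ _ (fine (nu n.+1 (C n.+1)))).
  apply: probability_Rintegral_le_measure => // y nCy; apply: contrapT => /eqP fy.
  by apply: nCy; apply: (C_nd _ _ Nn); apply: SN; exact: subset_closure.
by apply: le_trans (nuC n) _; rewrite lef_pV2 ?posrE// ler_nat.
Qed.

End convolution.

(** * Riesz representation and compactness of the space of probabilities *)

(** The enumeration [e] is fixed before the terms because the same one must rearrange both the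
    pointwise sums of a family of covers and the sums of their values under the functional. *)
Lemma nneseries_pair (R : realType) : exists e : nat -> nat * nat,
  forall a : nat -> nat -> \bar R, (forall n k, 0 <= a n k)%E ->
  (\sum_(n <oo) \sum_(k <oo) a n k = \sum_(m <oo) a (e m).1 (e m).2)%E.
Proof.
have /card_esym/ppcard_eqP[e] := card_nat2.
exists e => a a0.
rewrite [RHS]nneseries_esumT => [|m]; last exact: a0.
rewrite nneseries_esumT => [|n]; last by apply: nneseries_ge0 => *; exact: a0.
under eq_esum do (rewrite nneseries_esumT; last by move=> ?; exact: a0).
rewrite (esum_esum (J := fun=> setT))//.
have -> : [set: nat] `*`` (fun=> [set: nat]) = [set: nat * nat].
  by apply/seteqP; split => // -[].
by rewrite (@reindex_esum _ _ _ setT setT e)//; exact: bij.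
Qed.

Lemma nneseries_sup (R : realType) (u : nat -> \bar R) : (forall n, 0 <= u n)%E ->
  (\sum_(n <oo) u n = ereal_sup (range (fun N => \sum_(0 <= n < N) u n)))%E.
Proof.
move=> u0; apply/cvg_lim => //; apply: ereal_nondecreasing_cvgn.
by apply: ereal_nondecreasing_series => n _ _; exact: u0.
Qed.

Lemma continuous_sumr (R : realType) (K : topologicalType) (f : nat -> K -> R) n :
  (forall i, continuous (f i)) ->
  continuous (fun x => \sum_(0 <= i < n) f i x).
Proof.
move=> cf; elim: n => [|n IH].
  rewrite (_ : (fun _ => _) = fun=> 0); first by move=> x; exact: cvg_cst.
  by apply/funext => x; rewrite big_geq.
rewrite (_ : (fun _ => _) = fun x => \sum_(0 <= i < n) f i x + f n x).
  by move=> x; apply: cvgD; [exact: IH|exact: cf].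
by apply/funext => x; rewrite big_nat_recr.
Qed.

Section linear_functional.
Context (R : realType) (K : topologicalType) (L : (K -> R) -> R).
Hypothesis L_linear : forall (a : R) (f g : K -> R),
  continuous f -> continuous g -> L (fun x => a * f x + g x) = a * L f + L g.

Lemma functional0 : L (fun=> 0) = 0.
Proof.
have c0 : continuous (fun _ : K => 0 : R) by move=> x; exact: cvg_cst.
have := L_linear (-1) c0 c0; rewrite (_ : (fun _ => _) = fun=> 0).
  by move=> ->; rewrite mulN1r addNr.
by apply/funext => x; rewrite mulr0 addr0.
Qed.

Lemma functionalD (f g : K -> R) : continuous f -> continuous g ->
  L (fun x => f x + g x) = L f + L g.
Proof.
move=> cf cg; rewrite -[X in X + _]mul1r -L_linear//; congr L.
by apply/funext => x; rewrite mul1r.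
Qed.

Lemma functionalZ (a : R) (f : K -> R) : continuous f ->
  L (fun x => a * f x) = a * L f.
Proof.
move=> cf; rewrite -[RHS]addr0 -functional0 -L_linear//; last by move=> x; exact: cvg_cst.
by congr L; apply/funext => x; rewrite addr0.
Qed.

Lemma functionalB (f g : K -> R) : continuous f -> continuous g ->
  L (fun x => f x - g x) = L f - L g.
Proof.
move=> cf cg; rewrite -[X in _ - X]mul1r addrC -mulNr -L_linear//; congr L.
by apply/funext => x; rewrite mulN1r addrC.
Qed.

Lemma functional_sum (f : nat -> K -> R) n : (forall i, continuous (f i)) ->
  L (fun x => \sum_(0 <= i < n) f i x) = \sum_(0 <= i < n) L (f i).
Proof.
move=> cf; elim: n => [|n IH].
  by rewrite big_geq// -[RHS]functional0; congr L; apply/funext => x; rewrite big_geq.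
rewrite big_nat_recr//= -IH -functionalD//; last exact: continuous_sumr.
by congr L; apply/funext => x; rewrite big_nat_recr.
Qed.

End linear_functional.

Section compact_space.
Context (R : realType) (K : ptopologicalType).
Hypothesis cK : compact [set: K].

Lemma continuous_compact_bounded (f : K -> R) : continuous f -> bounded_fun f.
Proof.
move=> cf; have /compact_bounded[M [Mr HM]] : compact (f @` [set: K]).
  by apply: continuous_compact => //; apply: continuous_subspaceT => x; exact: cf.
by exists M; split => // r Mr' x _; apply: HM Mr' _ _; exists x.
Qed.

Lemma compact_Rintegral_linear (P : probability (borel K) R) (a : R) (f g : K -> R) :
  continuous f -> continuous g ->
  \int[P]_x (a * f x + g x) = a * \int[P]_x f x + \int[P]_x g x.
Proof.
have intg (h : K -> R) : continuous h -> P.-integrable setT (EFin \o h).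
  move=> ch; apply: measurable_bounded_integrable => //.
  - by rewrite [X in (X < _)%E](probability_setT P) ltry.
  - exact: continuous_borel_measurable.
  - exact: continuous_compact_bounded.
move=> cf cg; have caf : continuous (fun x => a * f x).
  by move=> x; apply: cvgM; [exact: cvg_cst|exact: cf].
by rewrite RintegralD//; [rewrite RintegralZl//; exact: intg|exact: intg|exact: intg].
Qed.

End compact_space.

Section riesz.
Context (R : realType) (K : ptopologicalType).
Hypotheses (hK : hausdorff_space K) (cK : compact [set: K]) (scK : @second_countable K).
Variable L : (K -> R) -> R.
Hypothesis L_linear : forall (a : R) (f g : K -> R),
  continuous f -> continuous g -> L (fun x => a * f x + g x) = a * L f + L g.
Hypothesis L_ge0 : forall f : K -> R, continuous f -> (forall x, 0 <= f x) -> 0 <= L f.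
Hypothesis L_1 : L (fun=> 1) = 1.

Let lcK : locally_compact [set: K].
Proof.
move=> x _; exists setT; first exact: filterT.
by split => //; exact: closedT.
Qed.

Let cC (c : R) : continuous (fun _ : K => c).
Proof. by move=> x; exact: cvg_cst. Qed.

Let cB (f g : K -> R) : continuous f -> continuous g -> continuous (fun x => f x - g x).
Proof. by move=> cf cg x; apply: cvgB; [exact: cf|exact: cg]. Qed.

Let cM (f g : K -> R) : continuous f -> continuous g -> continuous (fun x => f x * g x).
Proof. by move=> cf cg x; apply: cvgM; [exact: cf|exact: cg]. Qed.

Let cmin (f g : K -> R) : continuous f -> continuous g ->
  continuous (fun x => Num.min (f x) (g x)).
Proof. by move=> cf cg x; apply: continuous_min; [exact: cf|exact: cg]. Qed.

Let L_cst c : L (fun=> c) = c.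
Proof.
rewrite -[RHS]mulr1 -[X in _ * X]L_1 -(functionalZ L_linear)//; congr L.
by apply/funext => x; rewrite mulr1.
Qed.

Let L_le (f g : K -> R) : continuous f -> continuous g -> (forall x, f x <= g x) -> L f <= L g.
Proof.
move=> cf cg fg; rewrite -subr_ge0 -(functionalB L_linear)//; apply: L_ge0; first exact: cB.
by move=> x; rewrite subr_ge0.
Qed.

(* Daniell's outer measure: a set is covered by nonnegative continuous functions
   whose sum is at least 1 on it, at the cost of the sum of their L-values. *)
Definition function_cover (A : set K) (f : nat -> K -> R) :=
  [/\ forall n, continuous (f n), forall n x, 0 <= f n x &
      forall x, A x -> (1 <= \sum_(n <oo) (f n x)%:E)%E].

Definition riesz_outer (A : set K) : \bar R :=
  ereal_inf [set (\sum_(n <oo) (L (f n))%:E)%E | f in function_cover A].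

Let cover_ge0 A f n : function_cover A f -> (0 <= (L (f n))%:E)%E.
Proof. by move=> [cf f0 _]; rewrite lee_fin; apply: L_ge0. Qed.

Let riesz_outer_le A f : function_cover A f ->
  (riesz_outer A <= \sum_(n <oo) (L (f n))%:E)%E.
Proof. by move=> fA; apply: ereal_inf_lbound; exists f. Qed.

Let riesz_outer_le1 A (f : K -> R) : continuous f -> (forall x, 0 <= f x) ->
  (forall x, A x -> 1 <= f x) -> (riesz_outer A <= (L f)%:E)%E.
Proof.
move=> cf f0 fA; pose g n := if n is 0%N then f else fun=> 0.
have sumg (h : (K -> R) -> R) : h (fun=> 0) = 0 -> 0 <= h f ->
    (\sum_(n <oo) (h (g n))%:E = (h f)%:E)%E.
  move=> h0 hf; rewrite nneseries_recl//; last by move=> [|n] _; rewrite lee_fin//= h0.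
  by rewrite eseries_cond eseries0 ?adde0// => -[|n]//= _ _; rewrite h0.
rewrite -sumg//; last exact: L_ge0.
apply: riesz_outer_le; split.
- by case=> [|n]; [exact: cf|exact: cC].
- by case=> [|n] x /=.
- by move=> x Ax; rewrite (sumg (fun f => f x))// lee_fin fA.
Qed.

Let riesz_outer_pair A (g : nat -> nat -> K -> R) :
  (forall n k, continuous (g n k)) -> (forall n k x, 0 <= g n k x) ->
  (forall x, A x -> (1 <= \sum_(n <oo) \sum_(k <oo) (g n k x)%:E)%E) ->
  (riesz_outer A <= \sum_(n <oo) \sum_(k <oo) (L (g n k))%:E)%E.
Proof.
move=> cg g0 gA; have [e eE] := nneseries_pair R.
rewrite eE => [|n k]; last by rewrite lee_fin; exact: L_ge0.
apply: (riesz_outer_le (f := fun m => g (e m).1 (e m).2)); split => // x Ax.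
by rewrite -(eE (fun n k => (g n k x)%:E))// => [|n k]; [exact: gA|rewrite lee_fin].
Qed.

Let riesz_outer_ge0 A : (0 <= riesz_outer A)%E.
Proof.
by apply: le_ereal_inf_tmp => _ [f fA <-]; apply: nneseries_ge0 => n _ _; exact: (cover_ge0 n fA).
Qed.

Let riesz_outer_lee1 A : (riesz_outer A <= 1)%E.
Proof. by rewrite -L_1; apply: riesz_outer_le1. Qed.

Let riesz_outer_fin A : riesz_outer A \is a fin_num.
Proof. by rewrite ge0_fin_numE//; exact: le_lt_trans (riesz_outer_lee1 A) (ltry _). Qed.

Let riesz_outer0 : riesz_outer set0 = 0%E.
Proof.
by apply/eqP; rewrite eq_le riesz_outer_ge0 andbT -[leRHS](congr1 EFin (functional0 L_linear)); apply: riesz_outer_le1.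
Qed.

Let le_riesz_outer : {homo riesz_outer : A B / A `<=` B >-> (A <= B)%E}.
Proof.
move=> A B AB; apply: ereal_inf_le_tmp => _ [f [cf f0 fB] <-].
by exists f => //; split => // x /AB; exact: fB.
Qed.

Let riesz_outer_approx A (e : R) : 0 < e -> exists2 f, function_cover A f &
  (\sum_(n <oo) (L (f n))%:E <= riesz_outer A + e%:E)%E.
Proof.
move=> e0; have [_ [f fA <-] /ltW le] := lb_ereal_inf_adherent e0 (riesz_outer_fin A).
by exists f.
Qed.

Let riesz_outer_sigma_subadditive : sigma_subadditive riesz_outer.
Proof.
move=> A; apply/lee_addgt0Pr => e e0.
have ek0 (n : nat) : 0 < e / (2 ^ n.+1)%:R by rewrite divr_gt0// ltr0n expn_gt0.
have /choice[g gP] : forall n, exists f, function_cover (A n) f /\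
    (\sum_(k <oo) (L (f k))%:E <= riesz_outer (A n) + (e / (2 ^ n.+1)%:R)%:E)%E.
  by move=> n; have [f fA fe] := riesz_outer_approx (A n) (ek0 n); exists f.
apply: le_trans (epsilon_trick xpredT _ (ltW e0)) => //.
apply: (@le_trans _ _ (\sum_(n <oo) \sum_(k <oo) (L (g n k))%:E)%E).
  apply: riesz_outer_pair.
  - by move=> n k; have [[cg _ _] _] := gP n; exact: cg.
  - by move=> n k x; have [[_ g0 _] _] := gP n; exact: g0.
  - move=> x [n _ Anx]; have [[_ _ gA] _] := gP n; apply: (le_trans (gA x Anx)).
    have g0 m k : (0 <= (g m k x)%:E)%E by rewrite lee_fin; have [[_ g0 _] _] := gP m.
    rewrite [leRHS](@nneseriesD1 _ _ n)//; last by move=> m _; exact: nneseries_ge0.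
    by rewrite leeDl//; apply: nneseries_ge0 => *; exact: nneseries_ge0.
apply: lee_nneseries => [n _ _|n _]; last by have [_] := gP n.
by apply: nneseries_ge0 => k _ _; have [/(cover_ge0 k)] := gP n.
Qed.

HB.instance Definition _ := isOuterMeasure.Build R K riesz_outer
  riesz_outer0 riesz_outer_ge0 le_riesz_outer riesz_outer_sigma_subadditive.

(* Given a cover f of X and h_k = min(1, k g), which increases to the indicator
   of U = {g > 0}, the functions f_n (h_(k+1) - h_k) cover X `&` U, while the
   f_n (1 - h_(N n)) cover X `\` U; the costs add up to at most that of f plus
   an error which is small when the N n are large. *)
Let cozero_caratheodory (g : K -> R) : continuous g -> (forall x, 0 <= g x) ->
  riesz_outer.-caratheodory [set x | 0 < g x].
Proof.
move=> cg g0; apply: le_caratheodory_measurable => X; set U := [set x | _].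
pose h (k : nat) x := Num.min 1 (k%:R * g x).
have ch k : continuous (h k) by apply: cmin => //; exact: cM.
have h0 x : h 0%N x = 0 by rewrite /h mul0r min_r.
have h_ge0 k x : 0 <= h k x by rewrite /h le_min ler01 mulr_ge0.
have h_le1 k x : h k x <= 1 by rewrite /h ge_min lexx.
have h_nd k x : h k x <= h k.+1 x.
  by rewrite /h le_min ge_min lexx /= ge_min ler_wpM2r ?orbT// ler_nat.
have hU x : U x -> exists k, h k x = 1.
  move=> gx; exists (Num.bound (g x)^-1); rewrite /h min_l// -ler_pdivrMr// div1r.
  by rewrite ltW// archi_boundP// invr_ge0.
apply/lee_addgt0Pr => e e0; have e20 : 0 < e / 2 by rewrite divr_gt0.
have [f [cf f0 fX] fe] := riesz_outer_approx X e20.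
rewrite [X in (_ + X%:E)%E](splitr e) EFinD addeA.
apply: le_trans (leeD2r (e / 2)%:E fe) => {fe}.
pose G n k x := f n x * (h k.+1 x - h k x).
have cG n k : continuous (G n k) by apply: cM; [exact: cf|exact: cB].
have G0 n k x : 0 <= G n k x by rewrite mulr_ge0// subr_ge0.
have sumG n N x : \sum_(0 <= k < N) G n k x = f n x * h N x.
  by rewrite -mulr_sumr telescope_sumr// h0 subr0.
have sumLG n N : (\sum_(0 <= k < N) (L (G n k))%:E)%E = (L (fun x => f n x * h N x))%:E.
  rewrite sumEFin -(functional_sum L_linear)//; congr (L _)%:E.
  by apply/funext => x; rewrite sumG.
have LG0 n k : (0 <= (L (G n k))%:E)%E by rewrite lee_fin; exact: L_ge0.
have Lf0 n : (0 <= (L (f n))%:E)%E by rewrite lee_fin; exact: L_ge0.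
pose S n := (\sum_(k <oo) (L (G n k))%:E)%E.
have S_sup n : S n = ereal_sup (range (fun N => (L (fun x => f n x * h N x))%:E)).
  rewrite /S nneseries_sup//; congr ereal_sup.
  by apply: eq_imagel => N _; exact: sumLG.
have S0 n : (0 <= S n)%E by exact: nneseries_ge0.
have Sfin n : S n \is a fin_num.
  rewrite ge0_fin_numE// (@le_lt_trans _ _ (L (f n))%:E) ?ltry// S_sup.
  apply: ge_ereal_sup => _ [N _ <-]; rewrite lee_fin; apply: L_le => //; first exact: cM.
  by move=> x; rewrite ler_piMr.
have ek0 (n : nat) : 0 < e / 2 / (2 ^ n.+1)%:R by rewrite divr_gt0// ltr0n expn_gt0.
(* [S n] is the supremum over N of [L] of f_n h_N, and f_n is the sum of f_n h_N and f_n (1 - h_N);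
   for N large enough, the overlap of the two covers costs at most the n-th share of e/2. *)
have /choice[N NP] : forall n, exists N, (S n + (L (fun x => f n x * (1 - h N x)))%:E <=
    (L (f n))%:E + (e / 2 / (2 ^ n.+1)%:R)%:E)%E.
  move=> n; have := Sfin n; rewrite {1}S_sup => /(ub_ereal_sup_adherent (ek0 n)).
  rewrite -S_sup => -[_ [N _ <-] SN]; exists N.
  rewrite (_ : (fun x => _) = fun x => f n x - f n x * h N x); last first.
    by apply/funext => x; rewrite mulrBr mulr1.
  rewrite (functionalB L_linear)//; last exact: cM.
  move: SN; rewrite -(fineK (Sfin n)) -EFinB -!EFinD lte_fin lee_fin; lra.
have L1h n : (0 <= (L (fun x => (f n x * (1 - h (N n) x))%R))%:E)%E.
  rewrite lee_fin; apply: L_ge0; first by apply: cM => //; exact: cB.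
  by move=> x; rewrite mulr_ge0// subr_ge0.
apply: le_trans (epsilon_trick xpredT Lf0 (ltW e20)).
apply: (@le_trans _ _ (\sum_(n <oo) (S n + (L (fun x => (f n x * (1 - h (N n) x))%R))%:E))%E); last first.
  by apply: lee_nneseries => [n _ _|n _]; [rewrite adde_ge0|exact: NP].
rewrite nneseriesD//; apply: leeD.
- apply: riesz_outer_pair => // x [Xx Ux]; apply: (le_trans (fX x Xx)).
  apply: lee_nneseries => [n _ _|n _]; first by rewrite lee_fin.
  have [k hk] := hU x Ux.
  apply: le_trans (nneseries_lim_ge k _); last by move=> *; rewrite lee_fin.
  by rewrite sumEFin sumG hk mulr1.
- apply: (riesz_outer_le (f := fun n x => f n x * (1 - h (N n) x))); split.
  + by move=> n; apply: cM => //; exact: cB.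
  + by move=> n x; rewrite mulr_ge0// subr_ge0.
  + move=> x [Xx /negP]; rewrite -leNgt => gx; have {gx}gx : g x = 0 by apply/eqP; rewrite eq_le gx g0.
    apply: (le_trans (fX x Xx)).
    apply: lee_nneseries => [n _ _|n _]; rewrite lee_fin//.
    by rewrite /h gx mulr0 min_r// subr0 mulr1.
Qed.

(** Bump functions at its points exhibit an open set as a countable union of cozero sets. *)
Let open_caratheodory (U : set K) : open U -> riesz_outer.-caratheodory U.
Proof.
move=> oU; have [||A cA ->] := second_countable_bigcup
  (P := fun A => riesz_outer.-caratheodory A) (U := U) scK.
- exact: caratheodory_measurable_set0.
- move=> x Ux; have [|f [cf f01 fx fU _]] := compact_bump R hK lcK (@compact_set1 _ x) oU.
    by move=> _ ->.
  exists [set y | 0 < f y]; split.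
  + by apply: cozero_caratheodory => // y; case/andP: (f01 y).
  + apply: open_nbhs_nbhs; split; last by rewrite /= fx.
    by apply: (@open_comp _ _ f [set r | 0 < r]) => [y _|]; [exact: cf|exact: open_gt].
  + by move=> y /= fy; apply: fU; rewrite gt_eqF.
- exact: caratheodory_measurable_bigcup.
Qed.

(** As in Dini's theorem, the increasing partial sums of a cover of the compact space exceed [1 - e]
    everywhere after finitely many terms; to such a finite sum linearity and positivity of [L]
    apply. *)
Let riesz_outerT : riesz_outer setT = 1%E.
Proof.
apply/eqP; rewrite eq_le riesz_outer_lee1 /=.
apply: le_ereal_inf_tmp => _ [f [cf f0 fT] <-].
apply/lee_addgt0Pr => e e0.
have [N fN] : exists N, forall x, setT x -> 1 - e <= \sum_(0 <= n < N) f n x.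
  apply: (compact_ideal (P := fun A => exists N, forall x, A x ->
    1 - e <= \sum_(0 <= n < N) f n x) cK).
  - by exists 0%N.
  - have f_nd m n x : (m <= n)%N -> \sum_(0 <= i < m) f i x <= \sum_(0 <= i < n) f i x.
      by move=> mn; rewrite [leRHS](big_cat_nat (leq0n m) mn)//= lerDl sumr_ge0.
    move=> A B [m Am] [n Bn]; exists (maxn m n) => x [/Am|/Bn] /le_trans; apply.
      by apply: f_nd; exact: leq_maxl.
    by apply: f_nd; exact: leq_maxr.
  - by move=> A B AB [N BN]; exists N => x /AB/BN.
  - move=> x _; have := fT x I; rewrite nneseries_sup; last by move=> n; rewrite lee_fin.
    have e1 : ((1 - e)%:E < 1)%E by rewrite lte_fin; lra.
    move=> /(lt_le_trans e1)/ereal_sup_gt[_ [N _ <-]]; rewrite sumEFin lte_fin => fN.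
    exists [set y | 1 - e < \sum_(0 <= n < N) f n y]; last by exists N => y /ltW.
    apply: open_nbhs_nbhs; split => //.
    by apply: (@open_comp _ _ (fun y => \sum_(0 <= n < N) f n y) [set r | 1 - e < r]) => [y _|];
      [exact: continuous_sumr|exact: open_gt].
apply: (@le_trans _ _ ((\sum_(0 <= n < N) (L (f n))%:E) + e%:E)%E); last first.
  rewrite leeD2r//; apply: nneseries_lim_ge => n _ _.
  by rewrite lee_fin; exact: L_ge0.
rewrite sumEFin -(functional_sum L_linear)// -EFinD lee_fin -lerBlDr -[leLHS]L_cst.
apply: L_le => //; [exact: continuous_sumr|by move=> x; exact: fN].
Qed.

Let borel_caratheodory (A : set (borel K)) : measurable A ->
  riesz_outer.-caratheodory A.
Proof.
apply: (@smallest_sub _ (sigma_algebra setT) (@open K) riesz_outer.-caratheodory).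
  split=> [|B mB|B mB].
  - exact: caratheodory_measurable_set0.
  - by rewrite setTD; exact: caratheodory_measurable_setC.
  - exact: caratheodory_measurable_bigcup.
exact: open_caratheodory.
Qed.

Definition riesz_measure : set (borel K) -> \bar R := riesz_outer.

Let riesz_sigma_additive : semi_sigma_additive riesz_measure.
Proof.
move=> A mA tA mUA; apply: (@caratheodory_measure_sigma_additive _ _ riesz_outer A) => //.
  by move=> n; exact: (borel_caratheodory (mA n)).
exact: (borel_caratheodory mUA).
Qed.

HB.instance Definition _ := isMeasure.Build _ _ _ riesz_measure
  riesz_outer0 riesz_outer_ge0 riesz_sigma_additive.

HB.instance Definition _ :=
  Measure_isProbability.Build _ _ _ riesz_measure riesz_outerT.

Let riesz_regular : regular riesz_measure.
Proof.
apply: finite_measure_regular => //.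
by rewrite [X in (X < _)%E]riesz_outerT ltry.
Qed.

Let P : rprobability R K := RProbability riesz_regular.

Let J (f : K -> R) : R := \int[P]_x f x.

Let J_linear (a : R) (f g : K -> R) : continuous f -> continuous g ->
  J (fun x => a * f x + g x) = a * J f + J g.
Proof. exact: compact_Rintegral_linear. Qed.

(* Slice f into the layers g_i = min(f, (i+1)/n) - min(f, i/n).  Since g_(i+1)
   is at most 1/n and lives on A = {f >= (i+1)/n}, where n g_i = 1, its integral
   is at most P(A) / n <= L (g_i); only the layer g_0 is lost. *)
Let J_le (f : K -> R) : continuous f -> (forall x, 0 <= f x <= 1) -> J f <= L f.
Proof.
move=> cf f01; apply/ler_addgt0Pr => e e0.
have [N eN] : exists N : nat, e^-1 <= N%:R.
  by exists (Num.bound e^-1); apply/ltW/archi_boundP; rewrite invr_ge0 ltW.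
pose n : R := N.+1%:R.
have n0 : 0 < n by rewrite ltr0n.
have ne : n^-1 <= e.
  rewrite -[leRHS]invrK lef_pV2 ?posrE ?invr_gt0//.
  by apply: (le_trans eN); rewrite ler_nat.
pose h (i : nat) x := Num.min (f x) (i%:R / n).
have ch i : continuous (h i) by apply: cmin => //; exact: cC.
pose g (i : nat) x := h i.+1 x - h i x.
have cg i : continuous (g i) by exact: cB.
have step i : i.+1%:R / n = i%:R / n + n^-1 by rewrite -natr1 mulrDl mul1r.
have g01 i x : 0 <= g i x <= n^-1.
  have layer (a b c : R) : 0 < c -> 0 <= Num.min a (b + c) - Num.min a b <= c.
    by move=> c0; have [?|?] := leP a b; have [?|?] := leP a (b + c); apply/andP; split; lra.
  by rewrite /g /h step; apply: layer; rewrite invr_gt0.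
have sumg x : \sum_(0 <= i < N.+1) g i x = f x.
  rewrite telescope_sumr// /h mul0r divff ?gt_eqF//.
  by case/andP: (f01 x) => f0 f1; rewrite min_l// min_r// subr0.
have JE : J f = \sum_(0 <= i < N.+1) J (g i).
  rewrite -(functional_sum J_linear)//; congr J.
  by apply/funext => x; rewrite sumg.
have LE : L f = \sum_(0 <= i < N.+1) L (g i).
  rewrite -(functional_sum L_linear)//; congr L.
  by apply/funext => x; rewrite sumg.
have J0 : J (g 0%N) <= n^-1 by case/andP: (probability_Rintegral_le P (g01 0%N)).
have JL i : J (g i.+1) <= L (g i).
  rewrite -(ler_pM2l n0) -(functionalZ L_linear)// -(functionalZ J_linear)//.
  pose A := [set x | i.+1%:R / n <= f x].
  have cA : closed A.
    by apply: (@closed_comp _ _ f [set r | i.+1%:R / n <= r]) => [x _|]; [exact: cf|exact: closed_ge].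
  apply: (@le_trans _ _ (fine (P A))).
    apply: probability_Rintegral_le_measure; first exact: closed_borel.
      move=> x; case/andP: (g01 i.+1 x) => g0 g1.
      apply/andP; split; first by rewrite mulr_ge0// ltW.
      by rewrite -ler_pdivlMl// mulr1.
    move=> x /negP; rewrite -ltNge => fx; rewrite /g /h step.
    rewrite min_l; last by rewrite (le_trans (ltW fx))// lerDl invr_ge0 ltW.
    by rewrite min_l ?ltW// subrr mulr0.
  have PfA : P A \is a fin_num by rewrite fin_num_measure//; exact: closed_borel.
  rewrite -lee_fin fineK//; apply: riesz_outer_le1.
  - by apply: cM => //; exact: cC.
  - by move=> x; apply: mulr_ge0; [exact: ltW|case/andP: (g01 i x)].
  - move=> x Ax; rewrite /g /h min_r// min_r; last first.
      by rewrite (le_trans _ Ax)// step lerDl invr_ge0 ltW.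
    by rewrite step addrC addKr divff ?gt_eqF.
(* The two sums are compared with a shift: the first layer left out of [J f] costs at most 1/n, and
   the last layer left out of [L f] contributes a nonnegative value. *)
rewrite JE big_nat_recl//= addrC LE big_nat_recr//=.
have LN : 0 <= L (g N) by apply: L_ge0 => // x; case/andP: (g01 N x).
apply: lerD; last exact: le_trans J0 ne.
by apply: (@le_trans _ _ (\sum_(0 <= i < N) L (g i))); [exact: ler_sum|rewrite lerDl].
Qed.

(** For values in [0,1], [J_le] applied to [1 - f] gives the reverse inequality, as both functionals
    fix constants. An affine change of values then reaches every continuous function, which is
    bounded by compactness. *)
Theorem riesz_representation : exists P : rprobability R K,
  forall f : K -> R, continuous f -> \int[P]_x f x = L f.
Proof.
exists P.
have J1 (c : R) : J (fun=> c) = c.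
  by rewrite /J Rintegral_cst// [X in fine X](probability_setT P) mulr1.
have unitE (f : K -> R) : continuous f -> (forall x, 0 <= f x <= 1) -> J f = L f.
  move=> cf f01; apply/eqP; rewrite eq_le J_le//=.
  have c1 := @cC 1.
  have : J (fun x => 1 - f x) <= L (fun x => 1 - f x).
    apply: J_le => [|x]; first exact: cB.
    by case/andP: (f01 x) => f0 f1; rewrite subr_ge0 f1 gerBl.
  by rewrite (functionalB J_linear)// (functionalB L_linear)// J1 L_cst lerD2l lerN2.
move=> f cf; have [M [_ HM]] := continuous_compact_bounded cK cf.
pose B : R := `|M| + 1; have B0 : 0 < B by rewrite ltr_wpDl.
have fB x : `|f x| <= B.
  by apply: (HM B _ x) => //; rewrite (le_lt_trans (ler_norm M))// ltrDl.
pose g x := (f x + B) / (2 * B).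
have B20 : 0 < 2 * B by rewrite mulr_gt0.
have cg : continuous g.
  move=> x; apply: cvgM; last exact: cvg_cst.
  by apply: cvgD; [exact: cf|exact: cvg_cst].
have g01 x : 0 <= g x <= 1.
  have := fB x; rewrite ler_norml => /andP[f1 f2].
  apply/andP; split; first by apply: divr_ge0; [rewrite -lerBlDr sub0r|exact: ltW].
  by rewrite /g ler_pdivrMr// mul1r mulr_natl mulr2n lerD2r.
have fE : f = fun x => 2 * B * g x + - B.
  by apply/funext => x; rewrite /g mulrC divfK ?gt_eqF// addrK.
rewrite -/(J f) {1}fE J_linear// unitE// J1 [in RHS]fE L_linear// L_cst//.
Qed.

End riesz.

(** * Ultrafilter limits of probability measures *)

Lemma ultra_bounded_cvg (R : realType) (T : Type) (F : set_system T) (u : T -> R) (M : R) :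
  UltraFilter F -> (forall t, `|u t| <= M) -> exists l : R, u @ F --> l.
Proof.
move=> UF uM; have [|l [_ cl]] := @segment_compact R (- M) M (u @ F).
  by apply: (@filterS _ F _ setT); [move=> t _ /=; rewrite in_itv /= -ler_norml|exact: filterT].
exists l => B Bl; have [//|FB] := in_ultra_setVsetC (u @^-1` B) UF.
by have [r [nBr Br]] := cl (~` B) B FB Bl.
Qed.

Section compact_probabilities.
Context (R : realType) (K : ptopologicalType).
Hypotheses (hK : hausdorff_space K) (cK : compact [set: K]) (scK : @second_countable K).

Lemma rprobability_compact : compact [set: rprobability R K].
Proof.
rewrite compact_ultra => F UF _.
(* [lim] is meaningful only where the integrals converge along [F]. For continuous functions they
   do, since they stay in a compact interval and [F] is an ultrafilter. *)
pose L (f : K -> R) : R := lim ((fun mu : rprobability R K => \int[mu]_x f x) @ F).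
have Lcvg (f : K -> R) : continuous f ->
    (fun mu : rprobability R K => \int[mu]_x f x) @ F --> L f.
  move=> cf; have [M [_ HM]] := continuous_compact_bounded cK cf.
  suff /ultra_bounded_cvg[l ul] : forall mu : rprobability R K,
      `|\int[mu]_x f x| <= `|M| + 1.
    by rewrite /L (cvg_lim (@Rhausdorff R) ul).
  move=> mu; have fM x : `|f x| <= `|M| + 1.
    by apply: (HM _ _ x) => //; rewrite (le_lt_trans (ler_norm M))// ltrDl.
  have intf : mu.-integrable setT (EFin \o f).
    apply: measurable_bounded_integrable => //.
    - by rewrite [X in (X < _)%E](probability_setT mu) ltry.
    - exact: continuous_borel_measurable.
    - exact: continuous_compact_bounded.
  apply: le_trans (le_normr_Rintegral _ intf) _ => //.
  have nfM x : 0 <= `|f x| <= `|M| + 1 by rewrite normr_ge0 fM.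
  by case/andP: (probability_Rintegral_le mu nfM).
have cst_cvg (c : R) : (fun mu : rprobability R K => \int[mu]_x c) @ F --> c.
  rewrite (_ : (fun _ => _) = fun=> c); first exact: cvg_cst.
  apply/funext => mu.
  by rewrite Rintegral_cst// [X in fine X](probability_setT mu) mulr1.
have [|||P PL] := @riesz_representation R K hK cK scK L.
- move=> a f g cf cg.
  have cafg : continuous (fun x => a * f x + g x).
    by move=> x; apply: cvgD; [apply: cvgM; [exact: cvg_cst|exact: cf]|exact: cg].
  apply: cvg_lim => //; rewrite (_ : (fun _ => _) =
      fun mu : rprobability R K => a * \int[mu]_x f x + \int[mu]_x g x).
    by apply: cvgD; [apply: cvgM; [exact: cvg_cst|exact: Lcvg]|exact: Lcvg].
  by apply/funext => mu; exact: compact_Rintegral_linear.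
- move=> f cf f0; apply: (limr_ge _ _); first by apply/cvg_ex; exists (L f); exact: Lcvg.
  by apply: nearW => mu; apply: Rintegral_ge0.
- by apply: cvg_lim => //; exact: cst_cvg.
exists P; split => //; apply/weak_cvgP => -[f [cf bf]].
rewrite /weak_ev /= PL//; exact: Lcvg.
Qed.

End compact_probabilities.

Lemma compact_normed_convergence_property (R : realType) (K : ptopologicalType)
  (H : hypergroup R K) : @second_countable K ->
  compact [set: K] -> normed_convergence_property H.
Proof.
move=> scK cK mu; exists (fun=> hg_unit H); exists setT => //.
split; last exact: closedT.
exact: rprobability_compact (hg_hausdorff H) cK scK.
Qed.

Theorem theorem1 (R : realType) (K : ptopologicalType) (H : hypergroup R K)
    (hK : @second_countable K)
    (hm : exists m : {measure set (borel K) -> \bar R}, right_haar H m) :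
  normed_convergence_property H <-> compact [set: K].
Proof.
split; first exact: normed_convergence_property_compact.
exact: compact_normed_convergence_property.
Qed.
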